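(* Let $M$ be a locally $\aleph_0$-categorical structure, equipped with a localising metric, and let $M'$ be a reduct of $M$. Assume that $M$ and $M'$ share the same metric and the same automorphism group. Then $M'$ is locally $\aleph_0$-categorical, and is bi-definable with $M$.
   Context: Continuous logic with formulas allowed to take values in $[-\infty,\infty]$. A type is isolated if the logic topology and the type-metric topology coincide at it. A theory in a separable language is locally $\aleph_0$-categorical if, with $a\sim b\iff\mathrm{tp}(a,b)$ isolated: $\sim$ is an equivalence relation on every model, each $\sim$-class is an elementary substructure, a map between models is elementary iff it is elementary on each class and sends distinct classes to distinct classes, and there is a unique separable local model (one class) up to isomorphism; a structure is locally $\aleph_0$-categorical if its theory is and it is that model. A localising metric is a definable generalised metric ($[0,\infty]$-valued formula defining a metric possibly taking value $\infty$) with $d(a,b)<\infty\iff a\sim b$ in every model. Bi-definable means having the same definable predicates. *)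

(* Defs.v *)
From HB Require Import structures.
From mathcomp Require Import all_boot all_order all_algebra.
From mathcomp Require Import all_classical all_reals all_analysis.
Import Order.TTheory GRing.Theory Num.Theory.
Import numFieldNormedType.Exports.

Set Implicit Arguments.
Unset Strict Implicit.
Unset Printing Implicit Defensive.

Local Open Scope classical_set_scope.
Local Open Scope ring_scope.

(* Continuous logic with truth values in the compact space [-oo, +oo].  The
   uniform structure of [-oo, +oo] is measured through [contract], which embeds
   it into [-1, 1]; it is the one underlying the library topology of \bar R. *)
Definition value_dist (R : realType) (x y : \bar R) : R :=
  `|contract x - contract y|.

Definition generalised_metric (R : realType) (A : Type) (d : A -> A -> \bar R) :=
  [/\ forall x y, (0 <= d x y)%E,
      forall x y, d x y = 0%E <-> x = y,
      forall x y, d x y = d y x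
    & forall x y z, (d x z <= d x y + d y z)%E].

Definition metric_complete (R : realType) (A : Type) (d : A -> A -> \bar R) :=
  forall u : nat -> A,
    (forall e : R, 0 < e ->
       exists N : nat, forall m n : nat, (N <= m)%N -> (N <= n)%N ->
         (d (u m) (u n) < e%:E)%E) ->
    exists x, forall e : R, 0 < e ->
       exists N : nat, forall n : nat, (N <= n)%N -> (d (u n) x < e%:E)%E.

Record language (R : realType) := Language {
  pred_sym : Type;
  pred_arity : pred_sym -> nat;
  pred_modulus : pred_sym -> R -> R;
  pred_modulus_gt0 : forall P e, 0 < e -> 0 < pred_modulus P e;
  func_sym : Type;
  func_arity : func_sym -> nat;
  func_modulus : func_sym -> R -> R;
  func_modulus_gt0 : forall f e, 0 < e -> 0 < func_modulus f e }.

Section Logic.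
Context {R : realType}.

(* The distinguished metric may take the value +oo.  The conclusions of the
   uniform continuity axioms are weak inequalities, so that the class of
   structures is closed under ultraproducts. *)
Record structure_on (L : language R) (A : Type) := StructureOn {
  str_inhabited : inhabited A;
  dist : A -> A -> \bar R;
  interp_pred : forall P : pred_sym L, ('I_(pred_arity P) -> A) -> \bar R;
  interp_func : forall f : func_sym L, ('I_(func_arity f) -> A) -> A;
  dist_metric : generalised_metric dist;
  dist_complete : metric_complete dist;
  interp_pred_uc : forall (P : pred_sym L) (v w : 'I_(pred_arity P) -> A) (e : R),
    0 < e -> (forall i, (dist (v i) (w i) < (pred_modulus P e)%:E)%E) ->
    value_dist (interp_pred v) (interp_pred w) <= e;
  interp_func_uc : forall (f : func_sym L) (v w : 'I_(func_arity f) -> A) (e : R),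
    0 < e -> (forall i, (dist (v i) (w i) < (func_modulus f e)%:E)%E) ->
    (dist (interp_func v) (interp_func w) <= e%:E)%E }.

Record structure (L : language R) := Structure {
  carrier :> Type;
  structure_of :> structure_on L carrier }.

Inductive term (L : language R) (n : nat) : Type :=
| Var of 'I_n
| App (f : func_sym L) of 'I_(func_arity f) -> term L n.

(* [formula L n]: formulas with free variables x_0, ..., x_{n-1}; a quantifier
   binds x_0 of a formula in n.+1 variables. *)
Inductive formula (L : language R) (n : nat) : Type :=
| Dist of term L n & term L n
| Pred (P : pred_sym L) of 'I_(pred_arity P) -> term L n
| Conn (k : nat) (u : {ptws 'I_k -> \bar R} -> \bar R) of continuous u
    & 'I_k -> formula L n
| Sup of formula L n.+1
| Inf of formula L n.+1.

Definition env_cons (A : Type) (n : nat) (a : A) (v : 'I_n -> A) : 'I_n.+1 -> A :=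
  fun i => oapp v a (unlift ord0 i).

Section Eval.
Context {L : language R} {A : Type} (M : structure_on L A).

Fixpoint eval_term (n : nat) (t : term L n) (v : 'I_n -> A) : A :=
  match t with
  | Var i => v i
  | App f ts => interp_func M (fun i => eval_term (ts i) v)
  end.

Fixpoint eval (n : nat) (phi : formula L n) (v : 'I_n -> A) {struct phi} : \bar R :=
  match phi in formula _ _ return \bar R with
  | Dist s t => dist M (eval_term s v) (eval_term t v)
  | Pred P ts => interp_pred M (fun i => eval_term (ts i) v)
  | Conn k u _ phis => u (fun i => eval (phis i) v)
  | Sup psi => ereal_sup (range (fun a => eval psi (env_cons a v)))
  | Inf psi => ereal_inf (range (fun a => eval psi (env_cons a v)))
  end.

Definition definable_predicate (n : nat) (D : ('I_n -> A) -> \bar R) :=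
  forall e : R, 0 < e -> exists phi : formula L n,
    forall v, value_dist (D v) (eval phi v) <= e.

(* T = Th(M): a theory is a set of sentences phi, read as conditions phi = 0.
   Any condition phi = r has this form, by composing with a connective. *)
Definition theory_of : set (formula L 0) :=
  [set phi | forall v, eval phi v = 0%E].

Definition separable :=
  exists u : nat -> A, forall x (e : R), 0 < e ->
    exists n, (dist M (u n) x < e%:E)%E.

Definition tp (n : nat) (v : 'I_n -> A) : {ptws formula L n -> \bar R} :=
  fun phi => eval phi v.

Definition tuple_dist (n : nat) (v w : 'I_n -> A) : \bar R :=
  \big[Order.max/0%E]_(i < n) dist M (v i) (w i).

End Eval.

Section Maps.
Context {L : language R} {A B : Type}.
Variables (M : structure_on L A) (N : structure_on L B).

Definition elementary_on (C : set A) (f : A -> B) :=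
  forall n (phi : formula L n) (v : 'I_n -> A), (forall i, C (v i)) ->
    eval N phi (f \o v) = eval M phi v.

Definition elementary (f : A -> B) := elementary_on setT f.

Definition isomorphism (f : A -> B) :=
  [/\ bijective f,
      forall x y, dist N (f x) (f y) = dist M x y,
      forall (P : pred_sym L) (v : 'I_(pred_arity P) -> A),
        interp_pred N (f \o v) = interp_pred M v
    & forall (g : func_sym L) (v : 'I_(func_arity g) -> A),
        interp_func N (f \o v) = f (interp_func M v)].

End Maps.

Definition automorphism (L : language R) (A : Type) (M : structure_on L A)
  (f : A -> A) := isomorphism M M f.

(* Any structure on C with elementary inclusion is the induced one; its being a
   structure means that C is nonempty, complete and closed under functions. *)
Definition elementary_substructure (L : language R) (A : Type)
    (M : structure_on L A) (C : set A) :=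
  exists S : structure_on L {x : A | C x}, elementary S M (@proj1_sig A C).

Section Theories.
Context {L : language R} (T : set (formula L 0)).

Definition models (A : Type) (N : structure_on L A) :=
  forall phi, T phi -> forall v, eval N phi v = 0%E.

(* The language has a countable dense set of formulas, modulo T. *)
Definition separable_language := forall n, exists phi : nat -> formula L n,
  forall (psi : formula L n) (e : R), 0 < e -> exists k,
    forall N : structure L, models N ->
      forall v : 'I_n -> N, value_dist (eval N psi v) (eval N (phi k) v) <= e.

Definition type_space (n : nat) : set {ptws formula L n -> \bar R} :=
  [set p | exists (N : structure L) (v : 'I_n -> N), models N /\ p = tp N v].

Definition type_dist (n : nat) (p q : {ptws formula L n -> \bar R}) : \bar R :=
  ereal_inf [set r | exists (N : structure L) (v w : 'I_n -> N),
    [/\ models N, p = tp N v, q = tp N w & r = tuple_dist N v w]].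

(* Neighbourhood filters of p within the type space. *)
Definition logic_nbhs (n : nat) (p : {ptws formula L n -> \bar R}) :
    set_system {ptws formula L n -> \bar R} :=
  within (@type_space n) (nbhs p).

Definition metric_nbhs (n : nat) (p : {ptws formula L n -> \bar R}) :
    set_system {ptws formula L n -> \bar R} :=
  [set U | exists2 e : R, 0 < e &
    forall q, type_space q -> (type_dist p q < e%:E)%E -> U q].

Definition isolated (n : nat) (p : {ptws formula L n -> \bar R}) :=
  forall U, logic_nbhs p U <-> metric_nbhs p U.

Definition sim (A : Type) (N : structure_on L A) (a b : A) :=
  isolated (tp N (fun i : 'I_2 => if i == ord0 then a else b)).

Definition sim_class (A : Type) (N : structure_on L A) (a : A) : set A :=
  [set b | sim N a b].

Definition local (A : Type) (N : structure_on L A) := forall a b, sim N a b.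

Definition locally_aleph0_categorical_theory :=
  separable_language /\
  [/\ forall N : structure L, models N ->
        [/\ forall a : N, sim N a a,
            forall a b : N, sim N a b -> sim N b a
          & forall a b c : N, sim N a b -> sim N b c -> sim N a c],
      forall N : structure L, models N ->
        forall a : N, elementary_substructure N (sim_class N a),
      forall N1 N2 : structure L, models N1 -> models N2 ->
        forall f : N1 -> N2,
          elementary N1 N2 f <->
          (forall a, elementary_on N1 N2 (sim_class N1 a) f) /\
          (forall a b, ~ sim N1 a b -> ~ sim N2 (f a) (f b)),
      exists N : structure L, [/\ models N, separable N & local N]
    & forall N1 N2 : structure L,
        models N1 -> separable N1 -> local N1 ->
        models N2 -> separable N2 -> local N2 ->
        exists f : N1 -> N2, isomorphism N1 N2 f].

(* A generalised metric on all models, uniformly definable over T. *)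
Definition localising_metric (delta : forall N : structure L, N -> N -> \bar R) :=
  [/\ forall e : R, 0 < e -> exists phi : formula L 2,
        forall N : structure L, models N -> forall v : 'I_2 -> N,
          value_dist (delta N (v ord0) (v ord_max)) (eval N phi v) <= e,
      forall N : structure L, models N -> generalised_metric (delta N)
    & forall N : structure L, models N -> forall a b : N,
        (delta N a b < +oo)%E <-> sim N a b].

End Theories.

Definition locally_aleph0_categorical (L : language R) (A : Type)
    (M : structure_on L A) :=
  [/\ locally_aleph0_categorical_theory (theory_of M),
      separable M & local (theory_of M) M].

Section Reducts.
Context {L L' : language R} {A : Type}.
Variables (M' : structure_on L' A) (M : structure_on L A).

Definition reduct := forall n (D : ('I_n -> A) -> \bar R),
  definable_predicate M' D -> definable_predicate M D.

Definition bidefinable := forall n (D : ('I_n -> A) -> \bar R),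
  definable_predicate M' D <-> definable_predicate M D.

End Reducts.
End Logic.

(* Main.v *)
(* The reduct turns out to determine the full structure, as in Beth's theorem.

   Suppose two tuples c, e of the ultrapower of M over a free ultrafilter on nat
   have the same type in the language of M'.  By countable saturation and
   back-and-forth there are a separable L-elementary substructure S of the
   ultrapower and an L'-elementary permutation g of S with g(c) = e.  Since g is
   isometric it permutes the classes of S, i.e. the sets of points at finite
   distance.  Each class is a separable local model, hence a copy of M, so
   between two classes g is an automorphism of M', thus of M.  So g is
   L-elementary on every class, hence L-elementary, and c, e have the same type
   in the language of M.  By compactness each L-formula is determined on M, up
   to epsilon, by finitely many L'-formulas, and an inf-convolution writes it as
   a connective applied to them.

   For the theory of M', every model N' of Th(M') carries a model N of Th(M)
   with the same metric and the same interdefinability relations: embed N' into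
   an ultrapower of M', which is also an ultrapower of M, and apply the
   Tarski-Vaught test.  Then N and N' have the same isolated types. *)

From HB Require Import structures.
From mathcomp Require Import all_boot all_order all_algebra.
From mathcomp Require Import all_classical all_reals all_analysis.
From mathcomp Require Import ring lra.
Require Import Defs.
Import Order.TTheory GRing.Theory Num.Theory.
Import numFieldNormedType.Exports.

Set Implicit Arguments.
Unset Strict Implicit.
Unset Printing Implicit Defensive.

Local Open Scope classical_set_scope.
Local Open Scope ring_scope.

(** * Truth values in [-oo, +oo] *)

Section ValueDist.
Context {R : realType}.
Implicit Types (x y z : \bar R) (e r : R).

(** The hypothesis on automorphisms concerns the single structure [M], whereas the goal compares
    finite tuples. An [L']-elementary permutation can be produced inside an ultrapower, but that is
    in general neither separable nor local, hence no copy of [M]. This forces the passage to a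
    separable substructure and then to its classes. The classes are visible to an [L']-elementary
    map exactly because ~ means finite distance and the metric belongs to both structures; the axiom
    on maps that are elementary on each class and keep distinct classes apart reassembles the
    pieces. Definable predicates are only uniform limits of formulas, so the two languages are never
    translated formula by formula. Every comparison is a uniform error bound on [M]; within one
    language such a bound is a closed condition that passes to all models of the theory, and between
    two languages it is kept as part of the data. The type metric is an infimum over all models, so
    isolation can be transferred only once every model of one theory carries a model of the other on
    the same points. *)

Lemma value_distC x y : value_dist x y = value_dist y x.
Proof. by rewrite /value_dist distrC. Qed.

Lemma value_dist_ge0 x y : 0 <= value_dist x y.
Proof. exact: normr_ge0. Qed.

Lemma value_distxx x : value_dist x x = 0.
Proof. by rewrite /value_dist subrr normr0. Qed.

Lemma value_dist_triangle y x z :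
  value_dist x z <= value_dist x y + value_dist y z.
Proof. exact: ler_distD. Qed.

Lemma value_dist_eq0 x y : (forall e, 0 < e -> value_dist x y <= e) -> x = y.
Proof.
move=> xy; apply: contract_inj; apply/eqP; rewrite -subr_eq0 -normr_eq0.
apply/negPn/negP => n0; have p0 : 0 < `|contract x - contract y|.
  by rewrite lt_neqAle eq_sym n0 normr_ge0.
by have := xy (value_dist x y / 2); rewrite /value_dist divr_gt0// => /(_ isT); lra.
Qed.

Lemma value_dist_abs x y e : value_dist x y <= e ->
  contract x <= contract y + e /\ contract y <= contract x + e.
Proof. by rewrite /value_dist ler_norml => /andP[]; lra. Qed.

Lemma abs_value_dist x y e : contract x <= contract y + e ->
  contract y <= contract x + e -> value_dist x y <= e.
Proof. by move=> *; rewrite /value_dist ler_norml; apply/andP; split; lra. Qed.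

Lemma abs_value_dist_lt x y e : contract x < contract y + e ->
  contract y < contract x + e -> value_dist x y < e.
Proof. by move=> *; rewrite /value_dist ltr_norml; apply/andP; split; lra. Qed.

Lemma contract_ge x : -1 <= contract x.
Proof. by have := contract_le1 x; rewrite ler_norml => /andP[]. Qed.

Lemma contract_le x : contract x <= 1.
Proof. by have := contract_le1 x; rewrite ler_norml => /andP[]. Qed.

Lemma contract_expand r : contract (expand r : \bar R) =
  if 1 <= r then 1 else if r <= -1 then -1 else r.
Proof.
case: ifPn => [r1|]; first by rewrite expand1.
rewrite -ltNge => r1; case: ifPn => [rN1|]; first by rewrite expandN1.
by rewrite -ltNge => rN1; rewrite expandK// inE ler_norml; lra.
Qed.

Lemma expand_value_dist r s : value_dist (expand r) (expand s) <= `|r - s|.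
Proof.
rewrite /value_dist !contract_expand ler_norml; have := ler_norm (r - s).
have := ler_norm (- (r - s)); rewrite normrN.
by do !case: ifPn; rewrite -?ltNge => *; lra.
Qed.

Lemma expand_eq0 r : expand r = 0%E -> r = 0.
Proof.
move=> /(congr1 (@contract R)); rewrite contract_expand contract0.
by do !case: ifPn; lra.
Qed.

(* [contract] is 1-Lipschitz on the reals. *)
Lemma le_value_dist x y e : 0 <= e -> (0 <= x)%E -> (0 <= y)%E ->
  (x <= y + e%:E)%E -> (y <= x + e%:E)%E -> value_dist x y <= e.
Proof.
move=> e0; case: x => [a||]; case: y => [b||] //=; last first.
  by move=> *; rewrite value_distxx.
rewrite !lee_fin => a0 b0 ab ba.
have key (u v : R) : 0 <= u -> 0 <= v -> u <= v + e ->
    contract u%:E <= contract v%:E + e.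
  move=> u0 v0 uv; rewrite /contract !ger0_norm//.
  rewrite -lerBlDl; have -> : u / (1 + u) - v / (1 + v) =
      (u - v) / ((1 + u) * (1 + v)).
    by field; apply/andP; split; apply/eqP; lra.
  rewrite ler_pdivrMr; last by apply: mulr_gt0; lra.
  have := mulr_ge0 e0 (mulr_ge0 u0 v0); have := mulr_ge0 e0 u0.
  have := mulr_ge0 e0 v0.
  have -> : e * ((1 + u) * (1 + v)) = e + e * u + e * v + e * (u * v) by ring.
  lra.
by apply: abs_value_dist; exact: key.
Qed.


Lemma ereal_inf_near (T : Type) (f : T -> \bar R) e : inhabited T -> 0 < e ->
  exists a, contract (f a) < contract (ereal_inf (range f)) + e.
Proof.
move=> [a0] e0; set l := ereal_inf _.
(* When [contract l + e] leaves the range of [contract], every point is close enough. *)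
have [l1|l1] := ltP 1 (contract l + e).
  by exists a0; apply: le_lt_trans l1; exact: contract_le.
have cl : `|contract l + e| <= 1 by rewrite ler_norml l1; have := contract_ge l; lra.
have : (l < expand (contract l + e))%E.
  by rewrite -lt_contract expandK ?inE//; lra.
move=> /ereal_inf_lt[_ [a _ <-]]; rewrite -lt_contract expandK ?inE// => ?.
by exists a.
Qed.

Lemma contract_inf_le (T : Type) (f : T -> \bar R) a :
  contract (ereal_inf (range f)) <= contract (f a).
Proof. by rewrite le_contract; apply: ereal_inf_lbound; exists a. Qed.

Lemma value_dist_inf (T : Type) (f g : T -> \bar R) e : 0 <= e ->
  (forall a, value_dist (f a) (g a) <= e) ->
  value_dist (ereal_inf (range f)) (ereal_inf (range g)) <= e.
Proof.
move=> e0 fg; have [[a0]|nT] := pselect (inhabited T); last first.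
  have E (h : T -> \bar R) : range h = set0.
    by rewrite predeqE => x; split=> [[a]|//]; case: nT.
  by rewrite !E value_distxx.
apply/ler_addgt0Pr => d d0; apply: abs_value_dist.
  have [a ha] := ereal_inf_near g (inhabits a0) d0.
  by have [] := value_dist_abs (fg a); have := contract_inf_le f a; lra.
have [a ha] := ereal_inf_near f (inhabits a0) d0.
by have [] := value_dist_abs (fg a); have := contract_inf_le g a; lra.
Qed.

Lemma ereal_sup_range_inf (T : Type) (f : T -> \bar R) :
  ereal_sup (range f) = (- ereal_inf (range (fun a => - f a)))%E.
Proof. by rewrite ereal_supEN image_comp. Qed.

Lemma value_distN x y : value_dist (- x)%E (- y)%E = value_dist x y.
Proof. by rewrite /value_dist !contractN -opprD normrN. Qed.

Lemma value_dist_sup (T : Type) (f g : T -> \bar R) e : 0 <= e ->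
  (forall a, value_dist (f a) (g a) <= e) ->
  value_dist (ereal_sup (range f)) (ereal_sup (range g)) <= e.
Proof.
move=> e0 fg; rewrite !ereal_sup_range_inf value_distN.
by apply: value_dist_inf => // a; rewrite value_distN.
Qed.

Lemma finite_min_gt0 k (f : 'I_k -> R) : (forall i, 0 < f i) ->
  exists2 d, 0 < d & forall i, d <= f i.
Proof.
elim: k f => [|k IH] f f0; first by exists 1 => // -[].
have [d d0 df] := IH (fun i => f (lift ord0 i)) (fun i => f0 _).
exists (Num.min d (f ord0)) => [|i]; first by rewrite lt_min d0 f0.
by case: (unliftP ord0 i) => [j ->|->]; rewrite ge_min ?lexx ?orbT ?df.
Qed.

(** * Neighbourhoods and continuity on powers of [-oo, +oo] *)

Lemma nbhs_value_dist x (W : set (\bar R)) :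
  nbhs x W <-> exists2 e, 0 < e & forall y, value_dist x y < e -> W y.
Proof.
rewrite (nbhs_ballP x); split=> -[e e0 eW]; exists e => // y; exact: eW.
Qed.

Lemma cvg_ptws (T : Type) F (p : {ptws T -> \bar R}) : Filter F ->
  F --> p <-> forall t, (fun q : T -> \bar R => q t) @ F --> p t.
Proof.
move=> FF; have pT t : range (fun q : T -> \bar R => q t) = setT.
  by rewrite predeqE => v; split=> // _; exists (fun=> v).
split=> [/cvg_sup H t|H].
  have /cvg_image := H t; move=> /(_ (pT t)) H'.
  apply: cvg_trans H' => W /=; rewrite !nbhs_simpl /fmap /= => -[W' + <-].
  by apply: filterS => g W'g /=; exists g.
apply/cvg_sup => t; apply/cvg_image; first exact: pT.
move=> W /H Q; exists ((fun q : T -> \bar R => q t) @^-1` W) => //.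
by rewrite eqEsubset; split=> [j [? + <-//]|j Wj]; exists (fun=> j).
Qed.

(** The basic sets generate a filter that converges to [p] coordinatewise, so [nbhs p] lies inside
    it. [List.In] allows an index type without [eqType] structure, such as formulas. *)
Lemma nbhs_ptws (T : Type) (p : {ptws T -> \bar R}) W : nbhs p W <->
  exists (s : seq T) e, 0 < e /\
    forall q : T -> \bar R, (forall t, List.In t s -> value_dist (p t) (q t) < e) -> W q.
Proof.
split.
  pose F : set_system {ptws T -> \bar R} := [set W | exists (s : seq T) e, 0 < e /\
    forall q : T -> \bar R, (forall t, List.In t s -> value_dist (p t) (q t) < e) -> W q].
  have FF : Filter F.
    split.
    - by exists [::], 1.
    - move=> P Q [s [e [e0 sP]]] [s' [e' [e'0 s'Q]]].
      exists (s ++ s'), (Num.min e e'); split; first by rewrite lt_min e0 e'0.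
      move=> q H; split; [apply: sP|apply: s'Q] => t ts.
        by have := H t; rewrite List.in_app_iff lt_min => /(_ (or_introl ts))/andP[].
      by have := H t; rewrite List.in_app_iff lt_min => /(_ (or_intror ts))/andP[].
    - move=> P Q PQ [s [e [e0 sP]]]; exists s, e; split=> // q H; exact/PQ/sP.
  suff : F --> p by apply.
  apply/cvg_ptws => t V /nbhs_value_dist[e e0 eV].
  by exists [:: t], e; split=> // q H; apply: eV; apply: H; left.
move=> [s [e [e0 sW]]].
have FF : Filter (nbhs p) by exact: nbhs_filter.
suff : nbhs p [set q | forall t, List.In t s -> value_dist (p t) (q t) < e].
  by apply: (@filterS _ _ FF) => q; exact: sW.
elim: s {sW} => [|t s IH].
  by apply: (@filterS _ _ FF setT) (@filterT _ _ FF) => q _ t [].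
have : nbhs p [set q : {ptws T -> \bar R} | value_dist (p t) (q t) < e].
  have /cvg_ptws : nbhs p --> p by [].
  move=> /(_ t [set y | value_dist (p t) y < e]); apply.
  by apply/nbhs_value_dist; exists e.
move=> H; apply: (@filterS2 _ _ FF _ _ _ _ H IH) => q H1 H2 u [<-|us]//.
exact: H2.
Qed.

Lemma continuous_ptwsP k (u : {ptws 'I_k -> \bar R} -> \bar R) : continuous u <->
  forall p e, 0 < e -> exists2 d, 0 < d &
    forall q : 'I_k -> \bar R, (forall i, value_dist (p i) (q i) < d) ->
      value_dist (u p) (u q) < e.
Proof.
split=> [cu p e e0|cu p].
  have /cu : nbhs (u p) [set y | value_dist (u p) y < e].
    by apply/nbhs_value_dist; exists e.
  by move=> /nbhs_ptws[s [d [d0 sd]]]; exists d => // q pq; apply: sd.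
move=> V /nbhs_value_dist[e e0 eV]; have [d d0 dV] := cu p e e0.
apply/nbhs_ptws; exists (enum 'I_k), d; split=> // q H; apply: eV; apply: dV => i.
by apply: H; have := mem_enum 'I_k i; elim: (enum _) => //= j s IH;
  rewrite inE => /predU1P[->|/IH]; [left|right].
Qed.

(** The source of nearly all connectives below: a real function, Lipschitz for [value_dist], is
    pushed into [-oo, +oo] by the nonexpansive map [expand]. The one-sided bound suffices because
    [p] and [q] may be exchanged. *)
Lemma expand_continuous k (h : ('I_k -> \bar R) -> R) (C : R) : 0 < C ->
  (forall p q e, 0 < e -> (forall i, value_dist (p i) (q i) <= e) ->
    h p <= h q + C * e) ->
  continuous (fun p : {ptws 'I_k -> \bar R} => expand (h p)).
Proof.
move=> C0 hC; apply/continuous_ptwsP => p e e0; pose d := e / 2 / C.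
have d0 : 0 < d by rewrite !divr_gt0.
have CdE : C * d = e / 2 by rewrite /d; field; rewrite gt_eqF.
exists d => // q pq; apply: le_lt_trans (expand_value_dist _ _) _.
apply: (@le_lt_trans _ _ (e / 2)); last by lra.
have := hC p q d d0 (fun i => ltW (pq i)).
have := hC q p d d0 (fun i => _).
rewrite ler_norml CdE => H1 H2.
have {}H1 : h q <= h p + e / 2 by apply: H1 => i; rewrite value_distC ltW.
by apply/andP; split; lra.
Qed.

End ValueDist.

(** * Ultralimits *)

Section Ultralimit.
Context {R : realType} {I : Type} (U : set_system I) {UU : UltraFilter U}.
Implicit Types (x y : I -> \bar R).

Let UF : Filter U. Proof. exact: filter_filter. Qed.

Lemma ultraI P Q : U P -> U Q -> U (P `&` Q).
Proof. exact: filterI. Qed.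

Lemma ultra_ex P : U P -> exists i, P i.
Proof. exact: (@filter_ex _ U ultra_proper P). Qed.

Lemma ultra_forall k (P : 'I_k -> set I) : (forall j, U (P j)) ->
  U [set i | forall j, P j i].
Proof.
elim: k P => [|k IH] P UP; first by apply: (@filterS _ _ UF setT) filterT => i _ [].
apply: (@filterS2 _ _ UF _ _ _ _ (UP ord0) (IH _ (fun j => UP (lift ord0 j)))).
by move=> i Pi0 Pi j; case: (unliftP ord0 j) => [j' ->|->].
Qed.

Definition ulim x : \bar R := ereal_sup [set r | U [set i | (r <= x i)%E]].

Lemma ulim_lt x r : (ulim x < r)%E -> U [set i | (x i < r)%E].
Proof.
move=> xr; have [Ur|] := in_ultra_setVsetC [set i | (r <= x i)%E] UU.
  suff : (r <= ulim x)%E by rewrite leNgt xr.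
  exact: ereal_sup_ubound.
by apply: filterS => i /negP; rewrite -ltNge.
Qed.

Lemma lt_ulim x r : (r < ulim x)%E -> U [set i | (r < x i)%E].
Proof.
move=> /ereal_sup_gt[s Us rs]; apply: filterS Us => i; exact: lt_le_trans.
Qed.

Lemma ulim_near x e : 0 < e -> U [set i | value_dist (x i) (ulim x) < e].
Proof.
move=> e0; set l := ulim x.
have lo : U [set i | contract l < contract (x i) + e].
  have [l1|l1] := ltP (contract l - e) (-1).
    by apply: (@filterS _ _ UF setT) filterT => i _ /=; have := contract_ge (x i); lra.
  have cl : `|contract l - e| <= 1 by rewrite ler_norml; have := contract_le l; lra.
  have : (expand (contract l - e) < l)%E by rewrite -lt_contract expandK ?inE//; lra.
  move=> /lt_ulim; apply: filterS => i /=.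
  by rewrite -lt_contract expandK ?inE//; lra.
have hi : U [set i | contract (x i) < contract l + e].
  have [l1|l1] := ltP 1 (contract l + e).
    by apply: (@filterS _ _ UF setT) filterT => i _ /=; have := contract_le (x i); lra.
  have cl : `|contract l + e| <= 1 by rewrite ler_norml; have := contract_ge l; lra.
  have : (l < expand (contract l + e))%E by rewrite -lt_contract expandK ?inE//; lra.
  move=> /ulim_lt; apply: filterS => i /=.
  by rewrite -lt_contract expandK ?inE//; lra.
by apply: filterS2 lo hi => i /= *; apply: abs_value_dist_lt.
Qed.

Lemma ulim_value_dist_le x y e : U [set i | value_dist (x i) (y i) <= e] ->
  value_dist (ulim x) (ulim y) <= e.
Proof.
move=> Uxy; apply/ler_addgt0Pr => d d0; have d20 : 0 < d / 2 by rewrite divr_gt0.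
have := ultraI Uxy (ultraI (ulim_near x d20) (ulim_near y d20)).
move=> /ultra_ex[i [/= H1 [H2 H3]]].
have := value_dist_triangle (x i) (ulim x) (ulim y).
have := value_dist_triangle (y i) (x i) (ulim y).
rewrite (value_distC (ulim x) (x i)); lra.
Qed.

Lemma ulim_cst r : ulim (fun=> r) = r.
Proof.
apply: value_dist_eq0 => e e0; have [i /=] := ultra_ex (ulim_near (fun=> r) e0).
by rewrite value_distC => /ltW.
Qed.

Lemma ulim_unique x l : (forall e, 0 < e -> U [set i | value_dist (x i) l <= e]) ->
  ulim x = l.
Proof.
move=> xl; apply: value_dist_eq0 => e e0; rewrite -(ulim_cst l).
exact/ulim_value_dist_le/xl.
Qed.

Lemma ulim_le x r : U [set i | (x i <= r)%E] -> (ulim x <= r)%E.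
Proof.
move=> Ur; rewrite leNgt; apply/negP => /lt_ulim Ur'.
by have [i /= [+ ?]] := ultra_ex (ultraI Ur Ur'); rewrite leNgt => /negP.
Qed.

Lemma ulim_ge x r : U [set i | (r <= x i)%E] -> (r <= ulim x)%E.
Proof. exact: ereal_sup_ubound. Qed.

Lemma ulim_conn k (u : {ptws 'I_k -> \bar R} -> \bar R) (x : 'I_k -> I -> \bar R) :
  continuous u -> ulim (fun i => u (fun j => x j i)) = u (fun j => ulim (x j)).
Proof.
move=> /continuous_ptwsP cu; apply: ulim_unique => e e0.
have [d d0 du] := cu (fun j => ulim (x j)) e e0.
apply: filterS (ultra_forall (fun j => ulim_near (x j) d0)) => i /= xi.
by rewrite value_distC; apply/ltW/du => j; rewrite value_distC.
Qed.

(** The quantifier step of Łoś's theorem: near-minimisers are picked coordinate by coordinate, with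
    one error bound for all coordinates. *)
Lemma ulim_inf (A : Type) (f : I -> A -> \bar R) : inhabited A ->
  ulim (fun i => ereal_inf (range (f i))) =
  ereal_inf (range (fun s : I -> A => ulim (fun i => f i (s i)))).
Proof.
move=> iA; have [a0] := iA; apply: value_dist_eq0 => e e0.
have e20 : 0 < e / 2 by rewrite divr_gt0.
apply: abs_value_dist.
  have [|s hs] := ereal_inf_near (fun s : I -> A => ulim (fun i => f i (s i))) _ e20.
    by split=> _; exact: a0.
  suff : contract (ulim (fun i => ereal_inf (range (f i)))) <=
    contract (ulim (fun i => f i (s i))) by lra.
  apply/ler_addgt0Pr => d d0; have d20 : 0 < d / 2 by rewrite divr_gt0.
  have [i /= [H1 H2]] := ultra_ex (ultraI (ulim_near (fun i => ereal_inf (range (f i))) d20)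
    (ulim_near (fun i => f i (s i)) d20)).
  have [? ?] := value_dist_abs (ltW H1); have [? ?] := value_dist_abs (ltW H2).
  by have := contract_inf_le (f i) (s i); lra.
have /choice[s hs] : forall i, exists a,
    contract (f i a) < contract (ereal_inf (range (f i))) + e / 2.
  by move=> i; exact: ereal_inf_near.
have := contract_inf_le (fun s : I -> A => ulim (fun i => f i (s i))) s => /= H.
suff : contract (ulim (fun i => f i (s i))) <=
  contract (ulim (fun i => ereal_inf (range (f i)))) + e / 2 by lra.
apply/ler_addgt0Pr => d d0; have d20 : 0 < d / 2 by rewrite divr_gt0.
have [i /= [H1 H2]] := ultra_ex (ultraI (ulim_near (fun i => ereal_inf (range (f i))) d20)
  (ulim_near (fun i => f i (s i)) d20)).
have [? ?] := value_dist_abs (ltW H1); have [? ?] := value_dist_abs (ltW H2).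
by have := hs i; lra.
Qed.

End Ultralimit.

(** * Generalised metrics and formulas *)

Section GeneralisedMetric.
Context {R : realType} {A : Type} (d : A -> A -> \bar R).
Hypothesis dm : generalised_metric d.
Implicit Types (x y z : A) (e : R).

Lemma gmetric_ge0 x y : (0 <= d x y)%E.
Proof. by case: dm. Qed.

Lemma gmetricC x y : d x y = d y x.
Proof. by case: dm. Qed.

Lemma gmetric_xx x : d x x = 0%E.
Proof. by have [_ H _ _] := dm; apply/H. Qed.

Lemma gmetric_xx_lt x e : 0 < e -> (d x x < e%:E)%E.
Proof. by rewrite gmetric_xx lte_fin. Qed.

Lemma gmetric_lt_trans y x z a b :
  (d x y < a%:E)%E -> (d y z < b%:E)%E -> (d x z < (a + b)%:E)%E.
Proof.
have [_ _ _ T] := dm; move=> xy yz; apply: le_lt_trans (T x y z) _.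
by rewrite EFinD; exact: lteD.
Qed.

Lemma gmetric_eq x y : (forall e, 0 < e -> (d x y < e%:E)%E) -> x = y.
Proof.
have [ge0 H _ _] := dm; move=> xy; apply/H/eqP; rewrite eq_le ge0 andbT.
by apply/lee_addgt0Pr => e e0; rewrite add0e; exact/ltW/xy.
Qed.

Lemma gmetric_uc x x' y y' e : 0 < e -> (d x x' < e%:E)%E -> (d y y' < e%:E)%E ->
  value_dist (d x y) (d x' y') <= e + e.
Proof.
move=> e0 xx' yy'; have [ge0 _ dC T] := dm; apply: le_value_dist => //; first lra.
  apply: le_trans (T x x' y) _; rewrite addeC EFinD addeA; apply: leeD; last exact/ltW.
  by apply: le_trans (T x' y' y) _; apply: leeD => //; rewrite dC; exact/ltW.
apply: le_trans (T x' x y') _; rewrite addeC EFinD addeA; apply: leeD; last by rewrite dC ltW.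
by apply: le_trans (T x y y') _; apply: leeD => //; exact/ltW.
Qed.

End GeneralisedMetric.

Lemma proj1_sig_inj (T : Type) (P : T -> Prop) : injective (@proj1_sig T P).
Proof.
move=> [x px] [y py] /= xy; move: px py; rewrite xy => px py.
by rewrite (Prop_irrelevance px py).
Qed.

Lemma invSn_gt0 (R : realType) n : 0 < n.+1%:R^-1 :> R.
Proof. by rewrite invr_gt0 ltr0n. Qed.

Lemma invSn_lt (R : realType) (e : R) : 0 < e ->
  exists N, forall n, (N <= n)%N -> n.+1%:R^-1 < e.
Proof.
move=> e0; have [N hN] : exists N, e^-1 < N%:R.
  by exists (Num.truncn e^-1).+1; exact: truncnS_gt.
exists N => n Nn; rewrite invf_plt ?posrE//; apply: lt_le_trans hN _.
by rewrite ler_nat; exact: leqW.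
Qed.

Lemma nat_ultrafilter : exists U : set_system nat,
  UltraFilter U /\ forall k, U [set i | (k <= i)%N].
Proof.
have [U [UU FU]] := ultraFilterLemma (@eventually_filter).
by exists U; split=> // k; apply: FU; exists k.
Qed.

(** Heine-Cantor on the compact power of [-oo, +oo]: two sequences whose terms get ever closer have
    the same ultralimit, and continuity there rules out a gap [e] between their images. *)
Lemma conn_uc (R : realType) k (u : {ptws 'I_k -> \bar R} -> \bar R) : continuous u ->
  forall e : R, 0 < e -> exists2 d, 0 < d & forall p q : 'I_k -> \bar R,
    (forall i, value_dist (p i) (q i) < d) -> value_dist (u p) (u q) < e.
Proof.
move=> cu e e0; apply: contrapT => /forall2NP nuc.
have /choice[f hf] : forall n, exists pq : ('I_k -> \bar R) * ('I_k -> \bar R),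
    (forall i, value_dist (pq.1 i) (pq.2 i) < n.+1%:R^-1) /\
    e <= value_dist (u pq.1) (u pq.2).
  move=> n; have [|/existsNP[p /existsNP[q /not_implyP[H1 /negP H2]]]] := nuc n.+1%:R^-1.
    by rewrite invSn_gt0.
  by exists (p, q); split=> //; rewrite leNgt.
have [U [UU Uge]] := nat_ultrafilter.
pose P i n := (f n).1 i; pose Q i n := (f n).2 i.
have PQ i : ulim U (P i) = ulim U (Q i).
  apply: value_dist_eq0 => r r0; apply: ulim_value_dist_le.
  have [N hN] := invSn_lt r0; have FU : Filter U by exact: filter_filter.
  by apply: filterS (Uge N) => n /hN /ltW; apply: le_trans; have [/(_ i)/ltW] := hf n.
have e20 : 0 < e / 2 by rewrite divr_gt0.
have [n /= [H1 H2]] := ultra_ex (ultraI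
  (ulim_near (U := U) (fun n => u (fun i => P i n)) e20)
  (ulim_near (U := U) (fun n => u (fun i => Q i n)) e20)).
move: H1 H2; rewrite !ulim_conn//.
have -> : (fun j => ulim U (P j)) = (fun j => ulim U (Q j)) by exact/funext.
set l := u (fun j => ulim U (Q j)) => H1 H2; have [_ ge_e] := hf n.
have := value_dist_triangle l (u (f n).1) (u (f n).2).
rewrite (value_distC l (u (f n).2)) => tri.
have {}H1 : value_dist (u (f n).1) l < e / 2 by [].
have {}H2 : value_dist (u (f n).2) l < e / 2 by [].
lra.
Qed.

(** * Renaming of variables and uniform continuity of formulas *)

Section Formulas.
Context {R : realType} {L : language R}.

Lemma env_cons0 (A : Type) n a (v : 'I_n -> A) : env_cons a v ord0 = a.
Proof. by rewrite /env_cons unlift_none. Qed.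

Lemma env_consS (A : Type) n a (v : 'I_n -> A) i : env_cons a v (lift ord0 i) = v i.
Proof. by rewrite /env_cons liftK. Qed.

Lemma env_cons_eta (A : Type) n (v : 'I_n.+1 -> A) :
  env_cons (v ord0) (fun i => v (lift ord0 i)) = v.
Proof.
by apply/funext => i; case: (unliftP ord0 i) => [j ->|->]; rewrite ?env_consS ?env_cons0.
Qed.

Lemma comp_env_cons (A B : Type) (j : A -> B) n a (v : 'I_n -> A) :
  j \o env_cons a v = env_cons (j a) (j \o v).
Proof.
apply/funext => i; rewrite /comp.
by case: (unliftP ord0 i) => [k ->|->]; rewrite ?env_consS ?env_cons0.
Qed.

Fixpoint rename_term n m (s : 'I_n -> 'I_m) (t : term L n) : term L m :=
  match t with
  | Var i => Var L (s i)
  | App f ts => App (fun i => rename_term s (ts i))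
  end.

Definition lift_renaming n m (s : 'I_n -> 'I_m) : 'I_n.+1 -> 'I_m.+1 :=
  env_cons ord0 (fun i => lift ord0 (s i)).

Fixpoint rename n m (s : 'I_n -> 'I_m) (phi : formula L n) {struct phi} : formula L m :=
  match phi with
  | Dist t1 t2 => Dist (rename_term s t1) (rename_term s t2)
  | Pred P ts => Pred (fun i => rename_term s (ts i))
  | Conn k u cu phis => Conn cu (fun i => rename s (phis i))
  | Sup psi => Sup (rename (lift_renaming s) psi)
  | Inf psi => Inf (rename (lift_renaming s) psi)
  end.

Section OneStructure.
Context {A : Type} (M : structure_on L A).

Lemma eval_rename_term n m (s : 'I_n -> 'I_m) t v :
  eval_term M (rename_term s t) v = eval_term M t (v \o s).
Proof. by elim: t => //= f ts IH; congr interp_func; apply/funext. Qed.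

Lemma env_cons_lift_renaming n m (s : 'I_n -> 'I_m) a (v : 'I_m -> A) :
  env_cons a v \o lift_renaming s = env_cons a (v \o s).
Proof.
rewrite /lift_renaming comp_env_cons env_cons0; congr env_cons.
by apply/funext => i /=; rewrite env_consS.
Qed.

Lemma eval_rename n m (s : 'I_n -> 'I_m) phi v :
  eval M (rename s phi) v = eval M phi (v \o s).
Proof.
elim: phi m s v => {n} /=.
- by move=> n t1 t2 m s v; rewrite !eval_rename_term.
- by move=> n P ts m s v; congr interp_pred; apply/funext => i; rewrite eval_rename_term.
- by move=> n k u cu phis IH m s v; congr u; apply/funext => i; rewrite IH.
- by move=> n psi IH m s v; congr ereal_sup; apply: eq_imagel => a _;
    rewrite IH env_cons_lift_renaming.
- by move=> n psi IH m s v; congr ereal_inf; apply: eq_imagel => a _;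
    rewrite IH env_cons_lift_renaming.
Qed.

Lemma eval_term_uc n (t : term L n) (e : R) : 0 < e ->
  exists2 d, 0 < d & forall v w : 'I_n -> A, (forall i, (dist M (v i) (w i) < d%:E)%E) ->
    (dist M (eval_term M t v) (eval_term M t w) < e%:E)%E.
Proof.
elim: t e => [i|f ts IH] e e0 /=; first by exists e.
have e20 : 0 < e / 2 by rewrite divr_gt0.
have m0 := func_modulus_gt0 f e20.
have [d0 hd] := choice (fun i => let: ex_intro2 d p q := IH i _ m0 in
  ex_intro (fun d => 0 < d /\ _) d (conj p q)).
have [d dp dd] := finite_min_gt0 (fun i => (hd i).1).
exists d => // v w vw; apply: (@le_lt_trans _ _ (e / 2)%:E).
  apply: interp_func_uc => // i; apply: (hd i).2 => l; apply: lt_le_trans (vw l) _.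
  by rewrite lee_fin.
by rewrite lte_fin; lra.
Qed.

(** Lets near-witnesses and equalities of values pass from a dense set of points to its closure;
    connectives are handled by [conn_uc]. *)
Lemma eval_uc n (phi : formula L n) (e : R) : 0 < e ->
  exists2 d, 0 < d & forall v w : 'I_n -> A, (forall i, (dist M (v i) (w i) < d%:E)%E) ->
    value_dist (eval M phi v) (eval M phi w) <= e.
Proof.
elim: phi e => {n} /=.
- move=> n t1 t2 e e0; have e20 : 0 < e / 2 by rewrite divr_gt0.
  have [d1 d10 h1] := eval_term_uc t1 e20; have [d2 d20 h2] := eval_term_uc t2 e20.
  exists (Num.min d1 d2) => [|v w vw]; first by rewrite lt_min d10.
  rewrite [e]splitr; apply: gmetric_uc => //; first exact: dist_metric.
    by apply: h1 => i; apply: lt_le_trans (vw i) _; rewrite lee_fin ge_min lexx.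
  by apply: h2 => i; apply: lt_le_trans (vw i) _; rewrite lee_fin ge_min lexx orbT.
- move=> n P ts e e0; have m0 := pred_modulus_gt0 P e0.
  have [d0 hd] := choice (fun i => let: ex_intro2 d p q := eval_term_uc (ts i) m0 in
    ex_intro (fun d => 0 < d /\ _) d (conj p q)).
  have [d dp dd] := finite_min_gt0 (fun i => (hd i).1).
  exists d => // v w vw; apply: interp_pred_uc => // i; apply: (hd i).2 => l.
  by apply: lt_le_trans (vw l) _; rewrite lee_fin.
- move=> n k u cu phis IH e e0; have [c c0 hc] := conn_uc cu e0.
  have c20 : 0 < c / 2 by rewrite divr_gt0.
  have [d0 hd] := choice (fun i => let: ex_intro2 d p q := IH i _ c20 in
    ex_intro (fun d => 0 < d /\ _) d (conj p q)).
  have [d dp dd] := finite_min_gt0 (fun i => (hd i).1).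
  exists d => // v w vw; apply/ltW/hc => i.
  have H : value_dist (eval M (phis i) v) (eval M (phis i) w) <= c / 2.
    apply: (hd i).2 => l.
    by apply: lt_le_trans (vw l) _; rewrite lee_fin.
  by apply: le_lt_trans H _; lra.
- move=> n psi IH e e0; have [d dp hd] := IH e e0; exists d => // v w vw.
  apply: value_dist_sup => [|a]; first exact: ltW.
  apply: hd => i; case: (unliftP ord0 i) => [j ->|->]; rewrite ?env_consS// !env_cons0.
  exact/gmetric_xx_lt/dp/dist_metric.
- move=> n psi IH e e0; have [d dp hd] := IH e e0; exists d => // v w vw.
  apply: value_dist_inf => [|a]; first exact: ltW.
  apply: hd => i; case: (unliftP ord0 i) => [j ->|->]; rewrite ?env_consS// !env_cons0.
  exact/gmetric_xx_lt/dp/dist_metric.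
Qed.

End OneStructure.
End Formulas.

(** * Theories and elementary maps *)

Section Connectives.
Context {R : realType} {L : language R}.

Definition dist_formula n (i j : 'I_n) : formula L n := Dist (Var L i) (Var L j).

Definition graph_formula (f : func_sym L) : formula L (func_arity f).+1 :=
  Dist (Var L ord0) (App (fun i => Var L (lift ord0 i))).

Lemma eval_graph_formula A (M : structure_on L A) f x (v : 'I_(func_arity f) -> A) :
  eval M (graph_formula f) (env_cons x v) = dist M x (interp_func M v).
Proof.
rewrite /= env_cons0; congr (dist M _ (interp_func M _)).
by apply/funext => i; rewrite env_consS.
Qed.

Lemma opp_continuous : continuous (fun p : {ptws 'I_1 -> \bar R} => (- p ord0)%E).
Proof.
by apply/continuous_ptwsP => p e e0; exists e => // q /(_ ord0); rewrite value_distN.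
Qed.

Definition opp_formula n (phi : formula L n) : formula L n :=
  Conn (@opp_continuous) (fun=> phi).

(** Turns the closed condition that two values are within [e] into the vanishing of a formula, the
    form in which a theory records conditions. *)
Definition value_dist_excess (e : R) (p : 'I_2 -> \bar R) : R :=
  Num.max (value_dist (p ord0) (p ord_max) - e) 0.

Lemma value_dist_excess_continuous e :
  continuous (fun p : {ptws 'I_2 -> \bar R} => expand (value_dist_excess e p)).
Proof.
apply: (@expand_continuous _ _ _ 2) => // p q r r0 pq.
have H0 := pq ord0; have H1 := pq ord_max.
have T1 := value_dist_triangle (q ord0) (p ord0) (p ord_max).
have T2 := value_dist_triangle (q ord_max) (q ord0) (p ord_max).
rewrite ![value_dist (q _) (p _)]value_distC in T1 T2.
by rewrite /value_dist_excess ge_max; apply/andP; split;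
  rewrite -lerBlDr le_max; apply/orP; [left|right]; lra.
Qed.

Definition excess_formula n e (phi psi : formula L n) : formula L n :=
  Conn (@value_dist_excess_continuous e) (fun i => if i == ord0 then phi else psi).

Lemma eval_excess_formula A (M : structure_on L A) n e (phi psi : formula L n) v :
  eval M (excess_formula e phi psi) v = 0%E <->
  value_dist (eval M phi v) (eval M psi v) <= e.
Proof.
rewrite /= /value_dist_excess /=; split=> [/expand_eq0|H].
  by rewrite /Num.max; case: ifPn; rewrite ?subr_lt0 => *; lra.
by rewrite max_r ?expand0//; lra.
Qed.

(** Free variables are removed one at a time: if [phi] vanishes on [M], so do [Sup phi] and
    [Inf phi], and in [N] these two squeeze [phi] to 0. Both are used because values may have either
    sign. *)
Lemma theory_of_closed A (M : structure_on L A) B (N : structure_on L B) n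
    (phi : formula L n) : models (theory_of M) N ->
  (forall v, eval M phi v = 0%E) -> forall w, eval N phi w = 0%E.
Proof.
move=> NM; elim: n phi => [|n IH] phi phi0; first exact: NM.
have [a0] := str_inhabited M.
have E (v : 'I_n -> A) : range (fun a => eval M phi (env_cons a v)) = [set 0%E].
  by rewrite predeqE => x; split=> [[a _ <-]|->]; [rewrite phi0|exists a0; rewrite ?phi0].
have S0 := IH (Sup phi) (fun v => _); have I0 := IH (Inf phi) (fun v => _).
move=> w; rewrite -(env_cons_eta w); set v := (fun i => w (lift ord0 i)).
apply/eqP; rewrite eq_le; apply/andP; split.
  rewrite -(S0 _ v) /=; last by move=> u; rewrite E ereal_sup1.
  by apply: ereal_sup_ubound; exists (w ord0).
rewrite -(I0 _ v) /=; last by move=> u; rewrite E ereal_inf1.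
by apply: ereal_inf_lbound; exists (w ord0).
Qed.

Lemma theory_of_value_dist A (M : structure_on L A) B (N : structure_on L B) n
    (phi psi : formula L n) e : models (theory_of M) N ->
  (forall v, value_dist (eval M phi v) (eval M psi v) <= e) ->
  forall w, value_dist (eval N phi w) (eval N psi w) <= e.
Proof.
move=> NM H w; apply/eval_excess_formula.
apply: (theory_of_closed NM) => v; exact/eval_excess_formula/H.
Qed.

End Connectives.

Lemma models_self (R : realType) (L : language R) A (M : structure_on L A) :
  models (theory_of M) M.
Proof. by []. Qed.

Lemma elementary_models (R : realType) (L : language R) (T : set (formula L 0)) A B
    (M : structure_on L A) (N : structure_on L B) f :
  elementary M N f -> models T M <-> models T N.
Proof.
move=> Mf; split=> H phi Tphi v; last by rewrite -(Mf _ phi v)//; exact: H.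
have [a0] := str_inhabited M.
have -> : v = f \o (fun=> a0) by apply/funext => -[].
by rewrite Mf//; exact: H.
Qed.

Lemma elementary_dist (R : realType) (L : language R) A B
    (M : structure_on L A) (N : structure_on L B) f :
  elementary M N f -> forall x y, dist N (f x) (f y) = dist M x y.
Proof.
move=> Mf x y; have := Mf 2%N (dist_formula ord0 ord_max)
  (fun i => if i == ord0 then x else y) (fun=> I).
by [].
Qed.

Lemma isomorphism_elementary (R : realType) (L : language R) A B
    (M : structure_on L A) (N : structure_on L B) f :
  isomorphism M N f -> elementary M N f.
Proof.
case=> -[g gf fg] fd fP fF n phi v _.
have tf n' (t : term L n') w : eval_term N t (f \o w) = f (eval_term M t w).
  elim: t => //= h ts IH; rewrite -fF; congr interp_func.
  by apply/funext => i /=; rewrite IH.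
have rf (h : B -> \bar R) : range h = range (h \o f).
  rewrite predeqE => x; split=> [[b _ <-]|[a _ <-]]; last by exists (f a).
  by exists (g b); rewrite //= fg.
elim: phi v => {n} /=.
- by move=> n t1 t2 v; rewrite !tf fd.
- move=> n P ts v; rewrite -fP; congr interp_pred; apply/funext => i.
  by rewrite tf.
- by move=> n k u cu phis IH v; congr u; apply/funext => i; rewrite IH.
- move=> n psi IH v; rewrite rf; congr ereal_sup; apply: eq_imagel => a _ /=.
  by rewrite -comp_env_cons IH.
- move=> n psi IH v; rewrite rf; congr ereal_inf; apply: eq_imagel => a _ /=.
  by rewrite -comp_env_cons IH.
Qed.

Lemma elementary_isomorphism (R : realType) (L : language R) A B
    (M : structure_on L A) (N : structure_on L B) f :
  bijective f -> elementary M N f -> isomorphism M N f.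
Proof.
move=> bf Mf; split=> //; first exact: elementary_dist Mf.
- move=> P v; exact: (Mf _ (Pred (fun i => Var L i)) v).
- move=> g v; have := Mf _ (graph_formula g) (env_cons (interp_func M v) v) (fun=> I).
  rewrite comp_env_cons !eval_graph_formula (gmetric_xx (dist_metric M)).
  by have [_ dN0 _ _] := dist_metric N; move/dN0.
Qed.

Section TarskiVaught.
Context {R : realType} {L : language R} {K B : Type} (W : structure_on L K) (j : B -> K).
Hypothesis B_inhabited : inhabited B.
Hypothesis j_inj : injective j.
Hypothesis j_complete : metric_complete (fun x y => dist W (j x) (j y)).
Hypothesis j_inf : forall n (phi : formula L n.+1) (v : 'I_n -> B) (e : R), 0 < e ->
  exists b, contract (eval W phi (env_cons (j b) (j \o v))) <=
    contract (eval W (Inf phi) (j \o v)) + e.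

(** The graph formula has infimum 0, so the test gives points of [B] approaching the function value;
    completeness supplies their limit in [B]. *)
Let func_closed (f : func_sym L) (v : 'I_(func_arity f) -> B) :
  exists b, j b = interp_func W (j \o v).
Proof.
pose phi := graph_formula f.
have phiE (x : K) : eval W phi (env_cons x (j \o v)) = dist W x (interp_func W (j \o v)).
  exact: eval_graph_formula.
set y := interp_func W (j \o v) in phiE *.
have Wm := dist_metric W.
have inf0 : eval W (Inf phi) (j \o v) = 0%E.
  apply/eqP; rewrite eq_le; apply/andP; split.
    rewrite -(gmetric_xx Wm y) -phiE; apply: ereal_inf_lbound; by exists y.
  by apply: le_ereal_inf_tmp => _ [x _ <-]; have := gmetric_ge0 Wm x y; rewrite -phiE.
have near (e : R) : 0 < e -> exists b, (dist W (j b) y < e%:E)%E.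
  move=> e0; have c0 : 0 < contract e%:E by rewrite -(contract0 R) lt_contract lte_fin.
  have c20 : 0 < contract e%:E / 2 by rewrite divr_gt0.
  have [b] := j_inf phi v c20; rewrite inf0 contract0 add0r phiE => hb.
  by exists b; rewrite -lt_contract; lra.
have /choice[s hs] : forall n, exists b, (dist W (j b) y < n.+1%:R^-1%:E)%E.
  by move=> n; apply: near; exact: invSn_gt0.
have [e e0|b hb] := j_complete (u := s).
  have e20 : 0 < e / 2 by rewrite divr_gt0.
  have [N hN] := invSn_lt e20; exists N => m n Nm Nn.
  rewrite [e]splitr; apply: (gmetric_lt_trans Wm (y := y)).
    by apply: lt_trans (hs m) _; rewrite lte_fin hN.
  by rewrite gmetricC//; apply: lt_trans (hs n) _; rewrite lte_fin hN.
exists b; apply: (gmetric_eq Wm) => e e0; have e20 : 0 < e / 2 by rewrite divr_gt0.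
have [N1 h1] := hb _ e20; have [N2 h2] := invSn_lt e20.
pose n := maxn N1 N2; rewrite [e]splitr; apply: (gmetric_lt_trans Wm (y := j (s n))).
  by rewrite gmetricC// h1// leq_maxl.
by apply: lt_trans (hs n) _; rewrite lte_fin h2// leq_maxr.
Qed.

Let dist_metric' : generalised_metric (fun x y => dist W (j x) (j y)).
Proof.
have [H1 H2 H3 H4] := dist_metric W; split=> // x y; split=> [/H2/j_inj//|->].
exact/H2.
Qed.

Let interp_func' (f : func_sym L) v := projT1 (cid (@func_closed f v)).

Let j_interp_func f (v : 'I_(func_arity f) -> B) :
  j (interp_func' v) = interp_func W (j \o v).
Proof. exact: projT2 (cid (@func_closed f v)). Qed.

Let induced : structure_on L B.
Proof.
refine (@StructureOn R L B B_inhabited (fun x y => dist W (j x) (j y))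
  (fun P v => interp_pred W (j \o v)) interp_func' dist_metric' j_complete _ _).
- by move=> P v w e e0 vw; apply: interp_pred_uc.
- by move=> f v w e e0 vw; rewrite !j_interp_func; apply: interp_func_uc.
Defined.

Lemma tarski_vaught : exists S : structure_on L B, elementary S W j.
Proof.
exists induced => n phi v _.
have tE n' (t : term L n') w : eval_term W t (j \o w) = j (eval_term induced t w).
  elim: t => //= f ts IH; rewrite j_interp_func; congr interp_func.
  by apply/funext => i /=; rewrite IH.
have infE m (h : B -> \bar R) (psi : formula L m.+1) w :
    (forall b, h b = eval W psi (env_cons (j b) (j \o w))) ->
    eval W (Inf psi) (j \o w) = ereal_inf (range h).
  move=> hE; apply: contract_inj; apply/eqP; rewrite eq_le; apply/andP; split.
    rewrite le_contract; apply: le_ereal_inf_tmp => _ [b _ <-].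
    by rewrite hE; apply: ereal_inf_lbound; exists (j b).
  apply/ler_addgt0Pr => e e0; have [b hb] := j_inf psi w e0.
  apply: le_trans hb; rewrite -hE; exact: contract_inf_le.
elim: phi v => {n}.
- by move=> n t1 t2 v /=; rewrite !tE.
- move=> n P ts v /=; congr interp_pred; apply/funext => i.
  by rewrite tE.
- by move=> n k u cu phis IH v /=; congr u; apply/funext => i; rewrite IH.
(* The test speaks of infima only, so a supremum is treated as minus the infimum of the opposite
   formula. *)
- move=> n psi IH v; rewrite /= !ereal_sup_range_inf; congr (- _)%E.
  apply: (infE _ _ (opp_formula psi) v) => b /=; congr (- _)%E.
  by rewrite -comp_env_cons; exact/esym/IH.
- move=> n psi IH v; apply: infE => b.
  by rewrite -comp_env_cons; exact/esym/IH.
Qed.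

End TarskiVaught.

(** * Ultrapowers *)

Lemma half_exp_lt (R : realType) (e : R) : 0 < e -> exists n, 2^-1 ^+ n < e.
Proof.
move=> e0; have [n hn] := invSn_lt e0; exists n; apply: le_lt_trans (hn n (leqnn _)).
rewrite exprVn lef_pV2 ?posrE ?exprn_gt0 ?ltr0n//.
by rewrite -natrX ler_nat; exact: ltn_expl.
Qed.

Section UltrapowerCarrier.
Context {R : realType} {I : Type} (U : set_system I) {UU : UltraFilter U}.
Context {A : Type} (d : A -> A -> \bar R).
Hypothesis dm : generalised_metric d.
Implicit Types s t : I -> A.

Let UF : Filter U. Proof. exact: filter_filter. Qed.

Definition ueq s : set (I -> A) :=
  [set t | forall e : R, 0 < e -> U [set i | (d (s i) (t i) < e%:E)%E]].

Lemma ueq_refl s : ueq s s.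
Proof.
by move=> e e0; apply: (@filterS _ _ UF setT) filterT => i _; exact: gmetric_xx_lt.
Qed.

Lemma ueq_sym s t : ueq s t -> ueq t s.
Proof. by move=> st e /st; apply: filterS => i /=; rewrite gmetricC. Qed.

Lemma ueq_trans s t u : ueq s t -> ueq t u -> ueq s u.
Proof.
move=> st tu e e0; have e20 : 0 < e / 2 by rewrite divr_gt0.
apply: filterS2 (st _ e20) (tu _ e20) => i H1 H2 /=.
by rewrite [e]splitr; exact: gmetric_lt_trans H1 H2.
Qed.

(** The choice depends on [s] only through the set [ueq s], so equivalent functions receive the same
    representative, and the quotient can be encoded as the subtype of chosen representatives. *)
Definition urep s : I -> A := projT1 (cid (ex_intro (ueq s) s (ueq_refl s))).

Lemma ueq_urep s : ueq s (urep s).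
Proof. exact: projT2 (cid (ex_intro (ueq s) s (ueq_refl s))). Qed.

Lemma urep_eq s t : ueq s t -> urep s = urep t.
Proof.
move=> st; have E : ueq s = ueq t.
  by rewrite predeqE => u; split; apply: ueq_trans => //; exact: ueq_sym.
have cidE (P Q : set (I -> A)) (hP : exists x, P x) (hQ : exists x, Q x) : P = Q ->
    projT1 (cid hP) = projT1 (cid hQ).
  by move=> PQ; move: hP; rewrite PQ => hP; rewrite (Prop_irrelevance hP hQ).
exact: cidE.
Qed.

(** The carrier is built from the metric alone: structures in two languages with the same metric
    thus have ultrapowers on literally the same points. *)
Definition ultrapower := {s : I -> A | urep s = s}.

Definition urepr (x : ultrapower) : I -> A := proj1_sig x.

Definition ucls s : ultrapower :=
  exist _ (urep s) (urep_eq (ueq_sym (ueq_urep s))).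

Lemma urepr_cls s : ueq s (urepr (ucls s)).
Proof. exact: ueq_urep. Qed.

Lemma eq_ultrapower (x y : ultrapower) : ueq (urepr x) (urepr y) -> x = y.
Proof.
move=> /urep_eq st; apply: proj1_sig_inj.
by rewrite -(proj2_sig x) -(proj2_sig y).
Qed.

Lemma ucls_repr x : ucls (urepr x) = x.
Proof. by apply: eq_ultrapower; exact/ueq_sym/urepr_cls. Qed.

Lemma ucls_eq s t : ueq s t -> ucls s = ucls t.
Proof.
move=> st; apply: eq_ultrapower; apply: ueq_trans (urepr_cls t).
by apply: ueq_trans st; exact/ueq_sym/urepr_cls.
Qed.

Definition udist (x y : ultrapower) : \bar R := ulim U (fun i => d (urepr x i) (urepr y i)).

Lemma ulim_ueq s s' t t' : ueq s s' -> ueq t t' ->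
  ulim U (fun i => d (s i) (t i)) = ulim U (fun i => d (s' i) (t' i)).
Proof.
move=> ss' tt'; apply: value_dist_eq0 => e e0; apply: ulim_value_dist_le.
have e20 : 0 < e / 2 by rewrite divr_gt0.
apply: filterS2 (ss' _ e20) (tt' _ e20) => i H1 H2 /=.
by rewrite [e]splitr; apply: gmetric_uc.
Qed.

Lemma udist_cls s t : udist (ucls s) (ucls t) = ulim U (fun i => d (s i) (t i)).
Proof. by apply: ulim_ueq; exact/ueq_sym/urepr_cls. Qed.

Lemma udist_ltP s t e : (udist (ucls s) (ucls t) < e%:E)%E ->
  U [set i | (d (s i) (t i) < e%:E)%E].
Proof. by rewrite udist_cls; exact: ulim_lt. Qed.

Lemma ulim_le_lt (x : I -> \bar R) (e : R) : U [set i | (x i < e%:E)%E] ->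
  (ulim U x <= e%:E)%E.
Proof. by move=> H; apply: ulim_le; apply: filterS H => i /ltW. Qed.

Lemma udist_metric : generalised_metric udist.
Proof.
split.
- move=> x y; apply: ulim_ge; apply: (@filterS _ _ UF setT) filterT => i _ /=.
  exact: gmetric_ge0.
- move=> x y; split=> [xy|->].
    apply: eq_ultrapower => e e0; apply: ulim_lt.
    by rewrite -/(udist x y) xy lte_fin.
  rewrite /udist (_ : (fun i => _) = fun=> 0%E) ?ulim_cst//.
  by apply/funext => i; exact: gmetric_xx.
- by move=> x y; congr (ulim U); apply/funext => i; exact: gmetricC.
- move=> x y z; have ge0 u v : (0 <= udist u v)%E.
    apply: ulim_ge; apply: (@filterS _ _ UF setT) filterT => i _ /=.
    exact: gmetric_ge0.
  have := @ulim_lt _ _ U UU (fun i => d (urepr x i) (urepr y i)).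
  have := @ulim_lt _ _ U UU (fun i => d (urepr y i) (urepr z i)).
  rewrite -/(udist x y) -/(udist y z); move: (ge0 x y) (ge0 y z).
  case: (udist x y) => [a||]; case: (udist y z) => [b||] // _ _ Hb Ha; rewrite ?leey//.
  apply/lee_addgt0Pr => e e0; have e20 : 0 < e / 2 by rewrite divr_gt0.
  rewrite -!EFinD; apply: ulim_le_lt.
  have aa : (a%:E < (a + e / 2)%:E)%E by rewrite lte_fin; lra.
  have bb : (b%:E < (b + e / 2)%:E)%E by rewrite lte_fin; lra.
  apply: filterS2 (Ha _ aa) (Hb _ bb) => i H1 H2 /=.
  have -> : a + b + e = (a + e / 2) + (b + e / 2) by lra.
  exact: gmetric_lt_trans H1 H2.
Qed.

(* Given representatives with [d (w m i) (w m.+1 i) < 2 ^- m] for almost all i,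
   follow the i-th coordinate as long as these inequalities hold, and take its
   limit if they all do.  This works for every ultrafilter, even a countably
   complete one. *)
Lemma follow_coordinate (w : nat -> A) : metric_complete d -> exists y, forall m,
  (forall n, (n < m)%N -> (d (w n) (w n.+1) < (2^-1 ^+ n)%:E)%E) ->
  (d y (w m) < (4 * 2^-1 ^+ m)%:E)%E.
Proof.
move=> dc; pose good m := forall n, (n < m)%N -> (d (w n) (w n.+1) < (2^-1 ^+ n)%:E)%E.
have h0 n : 0 < 2^-1 ^+ n :> R by rewrite exprn_gt0// invr_gt0.
(* The factor [3 - 2 * 2^-1 ^+ k] equals 1 at [k = 0] and grows by [2^-1 ^+ k] at each step: it sums
   the geometric series and keeps the inequality strict. Passing to the limit costs one more
   [2^-1 ^+ m], whence the 4. *)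
have dist_wm m k : good (m + k)%N ->
    (d (w m) (w (m + k)%N) < ((3 - 2 * 2^-1 ^+ k) * 2^-1 ^+ m)%:E)%E.
  elim: k => [|k IH] gk.
    rewrite addn0; apply: gmetric_xx_lt => //; rewrite expr0.
    by apply: mulr_gt0 => //; lra.
  rewrite addnS in gk *; have {}IH := IH (fun n h => gk n (ltn_trans h (ltnSn _))).
  have gmk := gk (m + k)%N (ltnSn _).
  apply: lt_le_trans (gmetric_lt_trans dm IH gmk) _.
  rewrite lee_fin exprS exprD; have := h0 k; have := h0 m.
  by set u := 2^-1 ^+ k; set v := 2^-1 ^+ m; lra.
have bound m k : good (m + k)%N -> (d (w m) (w (m + k)%N) < (3 * 2^-1 ^+ m)%:E)%E.
  move=> /dist_wm H; apply: lt_le_trans H _; rewrite lee_fin.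
  by have := mulr_gt0 (h0 k) (h0 m); lra.
have [allgood|/existsNP[k0 nk0]] := pselect (forall m, good m).
  have [e e0|y hy] := dc w.
    have [N hN] : exists N, 3 * 2^-1 ^+ N < e / 2.
      have e60 : 0 < e / 6 by rewrite divr_gt0.
      by have [N hN] := half_exp_lt e60; exists N; lra.
    exists N => m n Nm Nn; rewrite [e]splitr; apply: (gmetric_lt_trans dm (y := w N)).
      rewrite gmetricC//; apply: lt_trans (_ : _ < (3 * 2^-1 ^+ N)%:E)%E _;
        last by rewrite lte_fin.
      by rewrite -(subnKC Nm); apply: bound.
    apply: lt_trans (_ : _ < (3 * 2^-1 ^+ N)%:E)%E _; last by rewrite lte_fin.
    by rewrite -(subnKC Nn); apply: bound.
  exists y => m _; have [N hN] := hy _ (h0 m).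
  have := bound m N (allgood _); have := hN (m + N)%N (leq_addl _ _).
  rewrite gmetricC// => H1; rewrite gmetricC// => H2.
  have -> : 4 * 2^-1 ^+ m = 2^-1 ^+ m + 3 * 2^-1 ^+ m :> R by lra.
  exact: gmetric_lt_trans H1 H2.
have exk : exists k, `[< ~ good k >] by exists k0; exact/asboolP.
have [k /asboolP nk mink] := ex_minnP exk.
have gk m : (m < k)%N -> good m.
  by move=> mk; apply: contrapT => /asboolP/mink; rewrite leqNgt mk.
have k0' : (0 < k)%N by rewrite lt0n; apply/eqP => kE; apply: nk; rewrite kE => n.
exists (w k.-1) => m gm; have mk : (m < k)%N.
  rewrite ltnNge; apply/negP => km; apply: nk => n nk; apply: gm.
  exact: leq_trans nk km.
have mk' : (m <= k.-1)%N by rewrite -ltnS prednK.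
rewrite gmetricC// -(subnKC mk'); apply: lt_trans (bound _ _ _) _.
  by rewrite subnKC//; apply: gk; rewrite prednK.
by rewrite lte_fin; have := h0 m; lra.
Qed.

Lemma udist_complete : metric_complete d -> metric_complete udist.
Proof.
move=> dc u cu; have h0 n : 0 < 2^-1 ^+ n :> R by rewrite exprn_gt0// invr_gt0.
have /choice[N0 hN0] := fun n => cu _ (h0 n).
pose N := fix N n := if n is n'.+1 then maxn (N n') (N0 n) else N0 0%N.
have NN0 n : (N0 n <= N n)%N by case: n => //= n; rewrite leq_maxr.
pose w n : I -> A := urepr (u (N n)).
have uw n : u (N n) = ucls (w n) by rewrite ucls_repr.
have wn n : U [set i | (d (w n i) (w n.+1 i) < (2^-1 ^+ n)%:E)%E].
  apply: udist_ltP; rewrite -!uw; apply: hN0; first exact: NN0.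
  by apply: leq_trans (NN0 n) _; rewrite /= leq_maxl.
have /choice[y hy] := fun i => follow_coordinate (fun n => w n i) dc.
have yw m : (udist (ucls y) (u (N m)) <= (4 * 2^-1 ^+ m)%:E)%E.
  rewrite uw udist_cls; apply: ulim_le_lt.
  apply: filterS (ultra_forall (fun j : 'I_m => wn j)) => i /= wi.
  by apply: hy => n nm; have := wi (Ordinal nm).
exists (ucls y) => e e0; have e20 : 0 < e / 2 by rewrite divr_gt0.
have [m hm] : exists m, 4 * 2^-1 ^+ m < e / 2.
  have e80 : 0 < e / 8 by rewrite divr_gt0.
  by have [N1 hN1] := half_exp_lt e80; exists N1; lra.
exists (N m) => n Nn; rewrite [e]splitr.
apply: (gmetric_lt_trans udist_metric (y := u (N m))).
  have := hN0 m n (N m) (leq_trans (NN0 m) Nn) (NN0 m) => H.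
  by apply: lt_trans H _; rewrite lte_fin; have := h0 m; lra.
by rewrite (gmetricC udist_metric); apply: le_lt_trans (yw m) _; rewrite lte_fin.
Qed.

End UltrapowerCarrier.

Section Ultrapower.
Context {R : realType} {I : Type} (U : set_system I) {UU : UltraFilter U}.
Context {A : Type} (d : A -> A -> \bar R) (dm : generalised_metric d).
Context {L : language R} (M : structure_on L A) (dM : dist M = d).

Local Notation K := (ultrapower (U := U) dm).
Local Notation cls := (ucls (U := U) dm).
Local Notation repr := (urepr (U := U) (dm := dm)).

Let UF : Filter U. Proof. exact: filter_filter. Qed.

Let dE x y : d x y = dist M x y. Proof. by rewrite dM. Qed.

Let upow_inhabited : inhabited K.
Proof. by have [a0] := str_inhabited M; exact: inhabits (cls (fun=> a0)). Qed.

Let upow_pred (P : pred_sym L) (v : 'I_(pred_arity P) -> K) : \bar R :=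
  ulim U (fun i => interp_pred M (fun k => repr (v k) i)).

Let upow_func (f : func_sym L) (v : 'I_(func_arity f) -> K) : K :=
  cls (fun i => interp_func M (fun k => repr (v k) i)).

Let upow_complete : metric_complete (udist (U := U) (dm := dm)).
Proof. by apply: udist_complete; rewrite -dM; exact: dist_complete. Qed.

Let upow_pred_uc (P : pred_sym L) (v w : 'I_(pred_arity P) -> K) (e : R) : 0 < e ->
  (forall i, (udist (v i) (w i) < (pred_modulus P e)%:E)%E) ->
  value_dist (upow_pred v) (upow_pred w) <= e.
Proof.
move=> e0 vw; apply: ulim_value_dist_le.
apply: filterS (ultra_forall (fun k => ulim_lt (vw k))) => i /= vwi.
by apply: interp_pred_uc => // k; rewrite -dE; exact: vwi.
Qed.

Let upow_func_uc (f : func_sym L) (v w : 'I_(func_arity f) -> K) (e : R) : 0 < e ->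
  (forall i, (udist (v i) (w i) < (func_modulus f e)%:E)%E) ->
  (udist (upow_func v) (upow_func w) <= e%:E)%E.
Proof.
move=> e0 vw; rewrite udist_cls; apply: ulim_le.
apply: filterS (ultra_forall (fun k => ulim_lt (vw k))) => i /= vwi.
by rewrite dE; apply: interp_func_uc => // k; rewrite -dE; exact: vwi.
Qed.

Definition upow : structure_on L K :=
  StructureOn upow_inhabited (udist_metric dm) upow_complete upow_pred_uc upow_func_uc.

Lemma los_term n (t : term L n) (v : 'I_n -> I -> A) :
  eval_term upow t (fun k => cls (v k)) = cls (fun i => eval_term M t (fun k => v k i)).
Proof.
elim: t => //= f ts IH; apply: ucls_eq => e e0.
have e20 : 0 < e / 2 by rewrite divr_gt0.
have m0 := func_modulus_gt0 f e20.
have H k : U [set i | (d (repr (eval_term upow (ts k) (fun k => cls (v k))) i)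
    (eval_term M (ts k) (fun k => v k i)) < (func_modulus f (e / 2))%:E)%E].
  by rewrite IH; apply: (ueq_sym dm _ m0); exact: urepr_cls.
apply: filterS (ultra_forall H) => i /= Hi.
apply: (@le_lt_trans _ _ (e / 2)%:E); last by rewrite lte_fin; lra.
by rewrite dE; apply: interp_func_uc => // k; rewrite -dE; exact: Hi.
Qed.

Lemma los n (phi : formula L n) (v : 'I_n -> I -> A) :
  eval upow phi (fun k => cls (v k)) = ulim U (fun i => eval M phi (fun k => v k i)).
Proof.
have ulimN (x : I -> \bar R) : ulim U (fun i => (- x i)%E) = (- ulim U x)%E.
  exact: (ulim_conn (fun=> x) (@opp_continuous R)).
have infE m (psi : formula L m.+1) (w : 'I_m -> I -> A) (h : K -> \bar R) :
    (forall s, h (cls s) = ulim U (fun i => eval M psi (env_cons (s i) (fun k => w k i)))) ->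
    ereal_inf (range h) = ulim U (fun i => eval M (Inf psi) (fun k => w k i)).
  move=> hE; rewrite /= ulim_inf; last exact: str_inhabited M.
  congr ereal_inf; rewrite predeqE => x; split=> [[y _ <-]|[s _ <-]].
    by exists (repr y) => //; rewrite -hE ucls_repr.
  by exists (cls s).
elim: phi v => {n}.
- by move=> n t1 t2 v /=; rewrite !los_term udist_cls; congr ulim; apply/funext => i; rewrite dE.
- move=> n P ts v /=; rewrite /upow_pred; apply: value_dist_eq0 => e e0.
  apply: ulim_value_dist_le; have m0 := pred_modulus_gt0 P e0.
  have H k : U [set i | (d (repr (eval_term upow (ts k) (fun k => cls (v k))) i)
      (eval_term M (ts k) (fun k => v k i)) < (pred_modulus P e)%:E)%E].
    by rewrite los_term; apply: (ueq_sym dm _ m0); exact: urepr_cls.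
  apply: filterS (ultra_forall H) => i /= Hi.
  by apply: interp_pred_uc => // k; rewrite -dE; exact: Hi.
- move=> n k u cu phis IH v /=; rewrite (ulim_conn _ cu); congr u.
  by apply/funext => i; rewrite IH.
- move=> n psi IH v; rewrite [LHS]/= ereal_sup_range_inf.
  rewrite (infE _ (opp_formula psi) v); last first.
    move=> s; rewrite [RHS]ulimN -IH.
    congr (- eval upow psi _)%E; apply/funext => k.
    by case: (unliftP ord0 k) => [j ->|->]; rewrite ?env_consS ?env_cons0.
  rewrite -ulimN; congr ulim.
  by apply/funext => i /=; rewrite -ereal_sup_range_inf.
- move=> n psi IH v; apply: infE => s; rewrite -IH; congr (eval upow psi _).
  apply/funext => k.
  by case: (unliftP ord0 k) => [j ->|->]; rewrite ?env_consS ?env_cons0.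
Qed.

Lemma losr n (phi : formula L n) (v : 'I_n -> K) :
  eval upow phi v = ulim U (fun i => eval M phi (fun k => repr (v k) i)).
Proof. by rewrite -los; congr eval; apply/funext => k; rewrite ucls_repr. Qed.

Lemma upow_models : models (theory_of M) upow.
Proof.
move=> phi phi0 v; rewrite losr (_ : (fun i => _) = fun=> 0%E) ?ulim_cst//.
by apply/funext => i; exact: phi0.
Qed.

End Ultrapower.
Arguments upow {R I} U {UU A d} dm {L M} dM.

(** * Companion structures *)

Section Companion.
Context {R : realType} {L1 L2 : language R}.

(* [N1] and [N2] are models of the theories of [M1] and [M2] in which the same
   formulas are interdefinable as in [M1] and [M2]. *)
Definition companion A (M1 : structure_on L1 A) (M2 : structure_on L2 A)
    B (N1 : structure_on L1 B) (N2 : structure_on L2 B) :=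
  (forall x y, dist N2 x y = dist N1 x y) /\
  forall n (phi1 : formula L1 n) (phi2 : formula L2 n) e,
    (forall v, value_dist (eval M1 phi1 v) (eval M2 phi2 v) <= e) ->
    forall w, value_dist (eval N1 phi1 w) (eval N2 phi2 w) <= e.

Lemma upow_companion I (U : set_system I) {UU : UltraFilter U} A d
    (dm : generalised_metric d) (M1 : structure_on L1 A) (M2 : structure_on L2 A)
    (dM1 : dist M1 = d) (dM2 : dist M2 = d) :
  companion M1 M2 (upow U dm dM1) (upow U dm dM2).
Proof.
split=> // n phi1 phi2 e H w; rewrite !losr; apply: ulim_value_dist_le.
have UF : Filter U by exact: filter_filter.
by apply: (@filterS _ _ UF setT) filterT => i _; exact: H.
Qed.

Context {A : Type} (M1 : structure_on L1 A) (M2 : structure_on L2 A).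
Hypothesis M2_reduct : reduct M2 M1.

Lemma reduct_approx n (psi : formula L2 n) (e : R) : 0 < e ->
  exists phi : formula L1 n, forall v, value_dist (eval M1 phi v) (eval M2 psi v) <= e.
Proof.
move=> e0; have [|phi hphi] := M2_reduct (D := eval M2 psi) _ e0.
  by move=> r r0; exists psi => v; rewrite value_distxx ltW.
by exists phi => v; rewrite value_distC.
Qed.

(** Each [L2]-formula is a uniform limit of [L1]-formulas on the base structures, and companions
    inherit the error bounds. *)
Lemma companion_elementary B C (N1 : structure_on L1 B) (W1 : structure_on L1 C)
    (N2 : structure_on L2 B) (W2 : structure_on L2 C) (P : set B) f :
  companion M1 M2 N1 N2 -> companion M1 M2 W1 W2 ->
  elementary_on N1 W1 P f -> elementary_on N2 W2 P f.
Proof.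
move=> [_ N12] [_ W12] Nf n psi v Pv; apply: value_dist_eq0 => e e0.
have e20 : 0 < e / 2 by rewrite divr_gt0.
have [phi hphi] := reduct_approx psi e20.
have H1 := N12 _ _ _ _ hphi v; have H2 := W12 _ _ _ _ hphi (f \o v).
move: H2; rewrite (Nf _ phi v Pv) value_distC => H2.
by have := value_dist_triangle (eval N1 phi v) (eval W2 psi (f \o v)) (eval N2 psi v); lra.
Qed.

Lemma companion_models B (N1 : structure_on L1 B) (N2 : structure_on L2 B) :
  companion M1 M2 N1 N2 -> models (theory_of M2) N2.
Proof.
move=> [_ N12] psi psi0 v; apply: value_dist_eq0 => e e0.
have e20 : 0 < e / 2 by rewrite divr_gt0.
have [phi hphi] := reduct_approx psi e20.
(* An [L1]-sentence vanishing in every structure, to which [psi] is compared; any nonnegative bound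
   would do in place of 2. *)
pose zero : formula L1 0 := excess_formula 2 phi phi.
have zeroE B' (N : structure_on L1 B') u : eval N zero u = 0%E.
  by apply/eval_excess_formula; rewrite value_distxx.
rewrite value_distC -(zeroE _ N1 v); apply: (N12 _ zero psi e) => u.
by rewrite zeroE psi0// value_distxx ltW.
Qed.

(** An [L1]-elementary part of [W1] passes the Tarski-Vaught test for [W2] as well: a near-witness
    for a uniformly close [L1]-formula is a near-witness for the [L2]-formula. *)
Lemma companion_sub B K (N1 : structure_on L1 B) (W1 : structure_on L1 K)
    (W2 : structure_on L2 K) (j : B -> K) :
  companion M1 M2 W1 W2 -> elementary N1 W1 j ->
  exists N2, companion M1 M2 N1 N2 /\ elementary N2 W2 j.
Proof.
move=> [W12d W12] Nj; have dj := elementary_dist Nj.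
have dW x y : dist W2 (j x) (j y) = dist N1 x y by rewrite W12d dj.
have [N2 N2j] : exists N2 : structure_on L2 B, elementary N2 W2 j.
  apply: tarski_vaught.
  - exact: str_inhabited N1.
  - move=> x y jxy; have [_ dN0 _ _] := dist_metric N1; apply/dN0.
    by rewrite -dW jxy (gmetric_xx (dist_metric W2)).
  - move=> u cu; have [|x hx] := @dist_complete _ _ _ N1 u.
      move=> e /cu[N hN]; exists N => m n Nm Nn; rewrite -dW; exact: hN.
    by exists x => e /hx[N hN]; exists N => n Nn; rewrite dW; exact: hN.
  - move=> n psi v e e0; have e40 : 0 < e / 4 by rewrite divr_gt0.
    have [phi hphi] := reduct_approx psi e40; have W12phi := W12 _ _ _ _ hphi.
    have infW : value_dist (eval W1 (Inf phi) (j \o v)) (eval W2 (Inf psi) (j \o v)) <= e / 4.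
      by apply: value_dist_inf => [|a]; [exact: ltW|exact: W12phi].
    rewrite (Nj _ (Inf phi) v) // in infW.
    have [b hb] := ereal_inf_near (fun a => eval N1 phi (env_cons a v)) (str_inhabited N1) e40.
    exists b; have := W12phi (env_cons (j b) (j \o v)).
    rewrite -comp_env_cons (Nj _ phi _)// => /value_dist_abs[_ ?].
    by have [? ?] := value_dist_abs infW; rewrite -/(eval N1 (Inf phi) v) in hb; lra.
exists N2; split=> //; split=> [x y|n phi psi e H w].
  by rewrite -(elementary_dist N2j) dW.
by rewrite -(Nj _ phi w)// -(N2j _ psi w)//; exact: W12.
Qed.

End Companion.

Lemma companion_sym (R : realType) (L1 L2 : language R) A
    (M1 : structure_on L1 A) (M2 : structure_on L2 A)
    B (N1 : structure_on L1 B) (N2 : structure_on L2 B) :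
  companion M1 M2 N1 N2 -> companion M2 M1 N2 N1.
Proof.
move=> [H1 H2]; split=> [x y|n phi2 phi1 e H w]; first by rewrite H1.
by rewrite value_distC; apply: H2 => v; rewrite value_distC.
Qed.

(** * Embedding a model of the theory of [M] into an ultrapower of [M] *)

Section Embedding.
Context {R : realType} {L : language R} {A B : Type}.
Variables (M : structure_on L A) (N : structure_on L B).
Hypothesis NM : models (theory_of M) N.

Let conds n (phi : formula L n) (v : 'I_n -> B) (e : R) : set (B -> A) :=
  [set s : B -> A | value_dist (eval M phi (s \o v)) (eval N phi v) < e].

Lemma finitely_realised n (phi : formula L n) (v : 'I_n -> B) (e : R) :
  0 < e -> exists s : B -> A, value_dist (eval M phi (s \o v)) (eval N phi v) < e.
Proof.
move=> e0; have [a0] := str_inhabited M.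
(* [s] merges the positions of equal entries of [v], so that [x \o s] comes from
   a map [B -> A] for every [x]. *)
pose s i := odflt i [pick k | `[< v k = v i >]].
have vs i : v (s i) = v i.
  by rewrite /s; case: pickP => [k /asboolP//|/(_ i)/asboolP]; case.
have s_eq i i' : v i = v i' -> s i = s i'.
  move=> E; rewrite /s; have -> : [pick k | `[< v k = v i >]] = [pick k | `[< v k = v i' >]].
    by apply: eq_pick => k /=; rewrite E.
  by case: pickP => [//|/(_ i')/asboolP]; case.
pose realise (x : 'I_n -> A) (b : B) : A :=
  match pselect (exists i, v i = b) with
  | left h => x (s (projT1 (cid h)))
  | right _ => a0
  end.
have realiseE x : realise x \o v = x \o s.
  apply/funext => i; rewrite /realise /=; case: pselect => [h|]; last by case; exists i.
  by congr x; apply: s_eq; case: (cid h).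
apply: contrapT => /forallNP H.
(* If no tuple of [M] came within [e] of [r], then [theta] below would vanish on [M], hence on [N];
   but at [v] it takes the value [expand e]. *)
pose r := eval N phi v; pose far (p : 'I_1 -> \bar R) := Num.max (e - value_dist (p ord0) r) 0.
have far_cont : continuous (fun p : {ptws 'I_1 -> \bar R} => expand (far p)).
  apply: (@expand_continuous _ _ _ 1) => // p q c c0 /(_ ord0) pq.
  have T := value_dist_triangle (p ord0) (q ord0) r; rewrite value_distC in pq.
  by rewrite /far ge_max; apply/andP; split; rewrite -lerBlDr le_max; apply/orP;
    [left|right]; lra.
pose theta : formula L n := Conn far_cont (fun=> rename s phi).
have : eval N theta v = 0%E.
  apply: (theory_of_closed NM) => x; rewrite /= eval_rename.
  have /negP := H (realise x); rewrite realiseE -leNgt => ge_e.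
  by rewrite /far max_r ?expand0//; lra.
rewrite /= eval_rename => /expand_eq0.
have -> : v \o s = v by exact/funext.
by rewrite /far value_distxx subr0 /Num.max; case: ifPn; lra.
Qed.

(** A single condition per set is enough for a filter, because two conditions merge into one through
    the maximum of their deviations. *)
Let base : set_system (B -> A) := [set X | exists n (phi : formula L n) (v : 'I_n -> B) (e : R),
  0 < e /\ conds phi v e `<=` X].

Let base_proper : ProperFilter base.
Proof.
have [b0] := str_inhabited N; split.
  move=> [n [phi [v [e [e0 sub]]]]]; have [s hs] := finitely_realised phi v e0.
  exact: sub hs.
split.
- by exists 1%N, (dist_formula ord0 ord0), (fun=> b0), 1.
- move=> X Y [n1 [phi1 [v1 [e1 [e10 sX]]]]] [n2 [phi2 [v2 [e2 [e20 sY]]]]].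
  pose r1 := eval N phi1 v1; pose r2 := eval N phi2 v2.
  pose far (p : 'I_2 -> \bar R) := Num.max (value_dist (p ord0) r1) (value_dist (p ord_max) r2).
  have far_cont : continuous (fun p : {ptws 'I_2 -> \bar R} => expand (far p)).
    apply: (@expand_continuous _ _ _ 1) => // p q c c0 pq.
    have T1 := value_dist_triangle (q ord0) (p ord0) r1; have H1 := pq ord0.
    have T2 := value_dist_triangle (q ord_max) (p ord_max) r2; have H2 := pq ord_max.
    by rewrite /far ge_max; apply/andP; split; rewrite -lerBlDr le_max; apply/orP;
      [left|right]; lra.
  pose theta : formula L (n1 + n2) := Conn far_cont (fun i =>
    if i == ord0 then rename (@lshift n1 n2) phi1 else rename (@rshift n1 n2) phi2).
  pose v k := match fintype.split k with inl i => v1 i | inr i => v2 i end.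
  have vl : v \o @lshift n1 n2 = v1.
    by apply/funext => i; rewrite /v /=; case: split_ordP => [k /lshift_inj->//|k /eqP];
      rewrite eq_lrshift.
  have vr : v \o @rshift n1 n2 = v2.
    by apply/funext => i; rewrite /v /=; case: split_ordP => [k /eqP|k /rshift_inj->//];
      rewrite eq_rlshift.
  (* The bound 1 stays below the saturation of [expand], so that a value within [e] of 0 bounds the
     maximum itself. *)
  pose e := Num.min 1 (Num.min e1 e2).
  exists (n1 + n2)%N, theta, v, e; split; first by rewrite !lt_min ltr01 e10 e20.
  have thetaE C (W : structure_on L C) u : eval W theta u = expand (Num.max
      (value_dist (eval W phi1 (u \o @lshift n1 n2)) r1)
      (value_dist (eval W phi2 (u \o @rshift n1 n2)) r2)).
    by rewrite /= /far /= !eval_rename.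
  move=> s; rewrite /conds /mkset !thetaE vl vr.
  have -> : (s \o v) \o @lshift n1 n2 = s \o v1 by rewrite -vl.
  have -> : (s \o v) \o @rshift n1 n2 = s \o v2 by rewrite -vr.
  rewrite (value_distxx r1) (value_distxx r2) maxxx expand0.
  set m := Num.max _ _; rewrite /value_dist contract0 subr0 contract_expand => H.
  have {H} : m < e.
    have e1' : e <= 1 by rewrite /e ge_min lexx.
    move: H; case: ifPn; first by rewrite normr1; lra.
    have m0 : 0 <= m by rewrite /m le_max value_dist_ge0.
    by case: ifPn => [? _|_ _ H]; [lra|exact: le_lt_trans (ler_norm m) H].
  rewrite /m /e gt_max !lt_min.
  by move=> /andP[/and3P[_ H1 _] /and3P[_ _ H2]]; split; [exact: sX|exact: sY].
- move=> X Y XY [n [phi [v [e [e0 sX]]]]]; exists n, phi, v, e; split=> //.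
  exact: subset_trans XY.
Qed.

(* The index set is [B -> A]: almost all maps preserve a given formula up to [e],
   and [b] is sent to the class of the evaluation at [b]. *)
Lemma exists_ultrapower_embedding : exists (U : set_system (B -> A)) (UU : UltraFilter U),
  elementary N (upow U (dist_metric M) (erefl (dist M)))
    (fun b => ucls (dist_metric M) (fun s => s b)).
Proof.
have [U [UU baseU]] := ultraFilterLemma base_proper.
exists U, UU => n phi v _.
rewrite (los (dist_metric M) (erefl (dist M)) phi (fun k s => s (v k))).
apply: ulim_unique => e e0; have UF : Filter U by exact: filter_filter.
have : U (conds phi v e).
  by apply: baseU; exists n, phi, v, e; split=> // ?.
by apply: filterS => s /ltW.
Qed.

End Embedding.

(** Bi-definability allows the roles of [M1] and [M2] to be exchanged, so models of either theory
    acquire the other structure. *)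
Lemma exists_companion (R : realType) (L1 L2 : language R) A
    (M1 : structure_on L1 A) (M2 : structure_on L2 A) B (N1 : structure_on L1 B) :
  reduct M2 M1 -> (forall x y, dist M2 x y = dist M1 x y) ->
  models (theory_of M1) N1 -> exists N2, companion M1 M2 N1 N2.
Proof.
move=> M2_red dM NM1; have dM2 : dist M2 = dist M1 by apply/funext => x; exact/funext.
have [U [UU Nj]] := exists_ultrapower_embedding NM1.
have W12 := upow_companion (U := U) (dist_metric M1) (erefl (dist M1)) dM2.
by have [N2 [N12 _]] := companion_sub M2_red (W12 UU) Nj; exists N2.
Qed.

(** * Transfer along bi-definability *)

(** A nullary connective inhabits [formula L n] even for [n = 0]; it is the default in enumerations
    of formulas. *)
Definition zero_formula (R : realType) (L : language R) n : formula L n.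
Proof.
refine (@Conn R L n 0%N (fun=> 0%E) (@cst_continuous _ _ 0%E) _).
by case.
Defined.

Lemma separable_sub (R : realType) (L1 L2 : language R) A B
    (N : structure_on L1 A) (S : structure_on L2 B) (j : B -> A) :
  (forall x y, dist N (j x) (j y) = dist S x y) -> separable N -> separable S.
Proof.
move=> dj [u hu]; have [b0] := str_inhabited S; have Nm := dist_metric N.
(* For each ball around a dense point that meets the image of [j], one point of [B] landing in it is
   kept; [b0] stands in for the other balls. *)
have /choice[f hf] : forall nm : nat * nat, exists b,
    (exists b', (dist N (u nm.1) (j b') < nm.2.+1%:R^-1%:E)%E) ->
    (dist N (u nm.1) (j b) < nm.2.+1%:R^-1%:E)%E.
  move=> nm; have [[b hb]|nb] := pselect (exists b',
      (dist N (u nm.1) (j b') < nm.2.+1%:R^-1%:E)%E).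
    by exists b.
  by exists b0.
exists (fun i => if unpickle i is Some nm then f nm else b0) => x e e0.
have e20 : 0 < e / 2 by rewrite divr_gt0.
have [m /(_ m (leqnn _)) hm] := invSn_lt e20.
have [n hn] := hu (j x) _ (invSn_gt0 R m).
exists (pickle (n, m)); rewrite pickleK -dj [e]splitr.
apply: (gmetric_lt_trans Nm (y := u n)).
  rewrite (gmetricC Nm); apply: lt_trans (hf (n, m) (ex_intro _ x hn)) _.
  by rewrite lte_fin.
by apply: lt_trans hn _; rewrite lte_fin.
Qed.

(** The selection of [separable_sub], now among formulas under the uniform distance on [M]:
    definable predicates of the reduct form a subspace of a separable space. *)
Lemma reduct_separable (R : realType) (L L' : language R) A
    (M : structure_on L A) (M' : structure_on L' A) :
  reduct M' M -> separable_language (theory_of M) ->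
  forall n, exists psi : nat -> formula L' n, forall (chi : formula L' n) (e : R), 0 < e ->
    exists k, forall v, value_dist (eval M' chi v) (eval M' (psi k) v) <= e.
Proof.
move=> red sepL n; have [phi hphi] := sepL n.
have /choice[f hf] : forall km : nat * nat, exists psi : formula L' n,
    (exists chi : formula L' n, forall v,
      value_dist (eval M (phi km.1) v) (eval M' chi v) <= km.2.+1%:R^-1) ->
    forall v, value_dist (eval M (phi km.1) v) (eval M' psi v) <= km.2.+1%:R^-1.
  move=> km; have [[chi hchi]|nchi] := pselect (exists chi : formula L' n, forall v,
      value_dist (eval M (phi km.1) v) (eval M' chi v) <= km.2.+1%:R^-1).
    by exists chi.
  by exists (zero_formula L' n).
exists (fun i => if unpickle i is Some km then f km else zero_formula L' n).
move=> chi e e0; have e20 : 0 < e / 2 by rewrite divr_gt0.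
have [m /(_ m (leqnn _)) hm] := invSn_lt e20; set d : R := m.+1%:R^-1 in hm.
have d20 : 0 < d / 2 by rewrite divr_gt0// invSn_gt0.
have [phi' hphi'] := reduct_approx red chi d20.
have [k hk] := hphi phi' _ d20; exists (pickle (k, m)); rewrite pickleK => v.
have kchi w : value_dist (eval M (phi k) w) (eval M' chi w) <= d.
  have := hk (Structure M) (@models_self _ _ _ M) w; have := hphi' w.
  have := value_dist_triangle (eval M phi' w) (eval M (phi k) w) (eval M' chi w).
  by rewrite (value_distC (eval M (phi k) w) (eval M phi' w)) /=; lra.
have := hf (k, m) (ex_intro _ chi kchi) v; rewrite -/d /= => H.
have := value_dist_triangle (eval M (phi k) v) (eval M' chi v) (eval M' (f (k, m)) v).
by rewrite (value_distC (eval M' chi v) (eval M _ v)); have := kchi v; lra.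
Qed.

Section Transfer.
Context {R : realType}.

Section TypeTransfer.
Context {L1 L2 : language R} {A : Type}.
Variables (M1 : structure_on L1 A) (M2 : structure_on L2 A).
Hypothesis M2_reduct : reduct M2 M1.
Hypothesis same_dist : forall x y, dist M2 x y = dist M1 x y.

Lemma companion_tp n B (N1 : structure_on L1 B) (N2 : structure_on L2 B)
    C (W1 : structure_on L1 C) (W2 : structure_on L2 C) (v : 'I_n -> B) (w : 'I_n -> C) :
  companion M1 M2 N1 N2 -> companion M1 M2 W1 W2 -> tp N1 v = tp W1 w ->
  tp N2 v = tp W2 w.
Proof.
move=> [_ N12] [_ W12] vw; apply/funext => psi; apply: value_dist_eq0 => e e0.
have e20 : 0 < e / 2 by rewrite divr_gt0.
have [phi hphi] := reduct_approx M2_reduct psi e20.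
have := N12 _ _ _ _ hphi v; have := W12 _ _ _ _ hphi w.
have /(congr1 (fun p => p phi)) := vw; rewrite /tp => ->.
have := value_dist_triangle (eval W1 phi w) (eval N2 psi v) (eval W2 psi w).
by rewrite (value_distC (eval N2 psi v) (eval W1 _ _)); lra.
Qed.

Lemma companion_type_dist_sub n B (N1 : structure_on L1 B) (N2 : structure_on L2 B)
    C (W1 : structure_on L1 C) (W2 : structure_on L2 C) (v : 'I_n -> B) (w : 'I_n -> C) :
  companion M1 M2 N1 N2 -> companion M1 M2 W1 W2 ->
  (type_dist (theory_of M2) (tp N2 v) (tp W2 w) <=
   type_dist (theory_of M1) (tp N1 v) (tp W1 w))%E.
Proof.
move=> N12 W12; apply: ereal_inf_le_tmp => _ [X [a [b [XM Na Wb ->]]]].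
have [X2 X12] := exists_companion M2_reduct same_dist XM.
exists (Structure X2), a, b; split=> /=.
- exact: companion_models X12.
- exact: companion_tp Na.
- exact: companion_tp Wb.
- by apply: eq_bigr => i _; rewrite X12.1.
Qed.

End TypeTransfer.

(** * Isolated types of companion structures *)

Section IsolationTransfer.
Context {L1 L2 : language R} {A : Type}.
Variables (M1 : structure_on L1 A) (M2 : structure_on L2 A).
Hypothesis M2_reduct : reduct M2 M1.
Hypothesis M1_reduct : reduct M1 M2.
Hypothesis same_dist : forall x y, dist M2 x y = dist M1 x y.

Let same_dist' x y : dist M1 x y = dist M2 x y. Proof. by rewrite same_dist. Qed.

Lemma companion_type_dist n B (N1 : structure_on L1 B) (N2 : structure_on L2 B)
    C (W1 : structure_on L1 C) (W2 : structure_on L2 C) (v : 'I_n -> B) (w : 'I_n -> C) :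
  companion M1 M2 N1 N2 -> companion M1 M2 W1 W2 ->
  type_dist (theory_of M2) (tp N2 v) (tp W2 w) =
  type_dist (theory_of M1) (tp N1 v) (tp W1 w).
Proof.
move=> N12 W12; apply/eqP; rewrite eq_le; apply/andP; split.
  exact: companion_type_dist_sub.
by apply: companion_type_dist_sub => //; exact: companion_sym.
Qed.

Lemma companion_type_space n (q : {ptws formula L2 n -> \bar R}) :
  type_space (theory_of M2) q -> exists (W1 : structure L1) (W2 : structure_on L2 W1)
    (w : 'I_n -> W1), [/\ models (theory_of M1) W1, companion M1 M2 W1 W2 & q = tp W2 w].
Proof.
move=> [W2 [w [W2M ->]]]; have [W1 W21] := exists_companion M1_reduct same_dist' W2M.
exists (Structure W1), W2, w; split=> //; first exact: companion_models W21.
exact: companion_sym.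
Qed.

Lemma companion_logic_nbhs n B (N1 : structure_on L1 B) (N2 : structure_on L2 B)
    (v : 'I_n -> B) (U1 : set {ptws formula L1 n -> \bar R})
    (U2 : set {ptws formula L2 n -> \bar R}) :
  companion M1 M2 N1 N2 ->
  (forall (W1 : structure L1) (W2 : structure_on L2 W1) (w : 'I_n -> W1),
     companion M1 M2 W1 W2 -> U1 (tp W1 w) -> U2 (tp W2 w)) ->
  logic_nbhs (theory_of M1) (tp N1 v) U1 -> logic_nbhs (theory_of M2) (tp N2 v) U2.
Proof.
move=> N12 U12 /nbhs_ptws[s [e [e0 sU]]].
have e40 : 0 < e / 4 by rewrite divr_gt0.
have /choice[f hf] := fun phi : formula L1 n => reduct_approx M1_reduct phi e40.
(* Radius [e / 4] around the approximating formulas, plus an approximation error [e / 4] at each of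
   the two types, stays below [e]. *)
apply/nbhs_ptws; exists (map f s), (e / 4); split=> // q qs /companion_type_space.
move=> [W1 [W2 [w [W1M W12 qE]]]]; rewrite qE; apply: U12 => //; apply: sU; last by exists W1, w.
move=> phi phis; have /qs : List.In (f phi) (map f s) by exact: List.in_map.
rewrite qE /tp => H; have H1 := (companion_sym N12).2 _ _ _ _ (hf phi) v.
have H2 := (companion_sym W12).2 _ _ _ _ (hf phi) w.
have := value_dist_triangle (eval N2 (f phi) v) (eval N1 phi v) (eval W1 phi w).
have := value_dist_triangle (eval W2 (f phi) w) (eval N2 (f phi) v) (eval W1 phi w).
by rewrite (value_distC (eval N1 phi v) (eval N2 _ v)); lra.
Qed.

Lemma companion_metric_nbhs n B (N1 : structure_on L1 B) (N2 : structure_on L2 B)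
    (v : 'I_n -> B) (U1 : set {ptws formula L1 n -> \bar R})
    (U2 : set {ptws formula L2 n -> \bar R}) :
  companion M1 M2 N1 N2 ->
  (forall (W1 : structure L1) (W2 : structure_on L2 W1) (w : 'I_n -> W1),
     companion M1 M2 W1 W2 -> U1 (tp W1 w) -> U2 (tp W2 w)) ->
  metric_nbhs (theory_of M1) (tp N1 v) U1 -> metric_nbhs (theory_of M2) (tp N2 v) U2.
Proof.
move=> N12 U12 [e e0 eU]; exists e => // q /companion_type_space.
move=> [W1 [W2 [w [W1M W12 ->]]]]; rewrite (companion_type_dist _ _ N12 W12) => H.
by apply: U12 => //; apply: eU => //; exists W1, w.
Qed.

End IsolationTransfer.

Lemma companion_isolated (L1 L2 : language R) A
    (M1 : structure_on L1 A) (M2 : structure_on L2 A)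
    n B (N1 : structure_on L1 B) (N2 : structure_on L2 B) (v : 'I_n -> B) :
  reduct M2 M1 -> reduct M1 M2 -> (forall x y, dist M2 x y = dist M1 x y) ->
  companion M1 M2 N1 N2 ->
  isolated (theory_of M1) (tp N1 v) -> isolated (theory_of M2) (tp N2 v).
Proof.
move=> red21 red12 dE N12 iso U2; have dE' x y : dist M1 x y = dist M2 x y by rewrite dE.
(* The preimage of [U2] under the correspondence of types. It quantifies over all realisations of
   [q], which share one [L2]-type by [companion_tp]. *)
pose U1 : set {ptws formula L1 n -> \bar R} := [set q |
  forall (W1 : structure L1) (W2 : structure_on L2 W1) (w : 'I_n -> W1),
    companion M1 M2 W1 W2 -> q = tp W1 w -> U2 (tp W2 w)].
have U12 (W1 : structure L1) (W2 : structure_on L2 W1) (w : 'I_n -> W1) :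
    companion M1 M2 W1 W2 -> U1 (tp W1 w) -> U2 (tp W2 w).
  by move=> W12; apply.
have U21 (W2 : structure L2) (W1 : structure_on L1 W2) (w : 'I_n -> W2) :
    companion M2 M1 W2 W1 -> U2 (tp W2 w) -> U1 (tp W1 w).
  move=> W21 Uw X1 X2 x X12 wx.
  by rewrite -(companion_tp red21 (companion_sym W21) X12 wx).
have N21 := companion_sym N12; split.
- move=> /(companion_logic_nbhs red21 dE' N21 U21)/iso.
  exact: companion_metric_nbhs.
- move=> /(companion_metric_nbhs red12 red21 dE' N21 U21)/iso.
  exact: companion_logic_nbhs.
Qed.

Lemma companion_sim (L1 L2 : language R) A
    (M1 : structure_on L1 A) (M2 : structure_on L2 A)
    B (N1 : structure_on L1 B) (N2 : structure_on L2 B) :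
  reduct M2 M1 -> reduct M1 M2 -> (forall x y, dist M2 x y = dist M1 x y) ->
  companion M1 M2 N1 N2 ->
  forall a b, sim (theory_of M2) N2 a b <-> sim (theory_of M1) N1 a b.
Proof.
move=> red21 red12 dE N12 a b; split; last exact: companion_isolated.
apply: companion_isolated => //; exact: companion_sym.
Qed.

(** Companions have the same metric, the same elementary maps and the same relation ~, so each
    clause about a model [N'] is read off its companion [N]. *)
Lemma bidefinable_locally_aleph0_categorical (L L' : language R) A
    (M : structure_on L A) (M' : structure_on L' A) :
  bidefinable M' M -> (forall x y, dist M' x y = dist M x y) ->
  locally_aleph0_categorical M -> locally_aleph0_categorical M'.
Proof.
move=> bid dE [[sepL [T1 T2 T3 T4 T5]] sepM locM].
have red : reduct M' M by move=> n D /bid.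
have red' : reduct M M' by move=> n D /bid.
have dE' x y : dist M x y = dist M' x y by rewrite dE.
have MM' : companion M M' M M' by [].
have comp (N' : structure L') : models (theory_of M') N' ->
    exists N : structure_on L N', models (theory_of M) N /\ companion M M' N N'.
  move=> N'M; have [N N'N] := exists_companion red' dE' N'M; exists N; split.
    exact: companion_models N'N.
  exact: companion_sym.
have simE := fun B (N : structure_on L B) (N' : structure_on L' B) =>
  @companion_sim _ _ _ M M' B N N' red red' dE.
have classE B (N : structure_on L B) (N' : structure_on L' B) a : companion M M' N N' ->
    sim_class (theory_of M') N' a = sim_class (theory_of M) N a.
  by move=> NN'; rewrite predeqE => b; exact: (simE _ _ _ NN').
have sep B (N : structure_on L B) (N' : structure_on L' B) : companion M M' N N' ->
    separable N' -> separable N.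
  by move=> NN'; apply: (separable_sub (j := id)) => x y; rewrite NN'.1.
have sepM' : separable M' by apply: (separable_sub (j := id)) sepM => x y; rewrite dE.
have locM' : local (theory_of M') M' by move=> a b; apply/(simE _ _ _ MM').
split=> //; split.
  move=> n; have [psi hpsi] := reduct_separable red sepL n; exists psi => chi e e0.
  have [k hk] := hpsi chi e e0; exists k => N NM; exact: theory_of_value_dist hk.
split.
- move=> N' /comp[N [NM NN']]; have [H1 H2 H3] := T1 (Structure N) NM; split=> [a|a b|a b c].
  + exact/(simE _ _ _ NN').
  + by move=> /(simE _ _ _ NN') ?; apply/(simE _ _ _ NN'); exact: H2.
  + move=> /(simE _ _ _ NN') ab /(simE _ _ _ NN') bc; apply/(simE _ _ _ NN').
    exact: H3 ab bc.
- move=> N' /comp[N [NM NN']] a; rewrite (classE _ _ _ _ NN').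
  have [S SN] := T2 (Structure N) NM a.
  by have [S' [_ S'N']] := companion_sub red NN' SN; exists S'.
- move=> N1' N2' /comp[N1 [N1M NN1]] /comp[N2 [N2M NN2]] f.
  have elemE P : elementary_on N1' N2' P f <-> elementary_on N1 N2 P f.
    split; last exact: (companion_elementary red NN1 NN2).
    exact: (companion_elementary red' (companion_sym NN1) (companion_sym NN2)).
  have [H1 H2] := T3 (Structure N1) (Structure N2) N1M N2M f; split.
    move=> /elemE/H1[H3 H4]; split=> [a|a b].
      by apply/elemE; rewrite (classE _ _ _ _ NN1).
    by move=> nab; move/(simE _ _ _ NN2); apply: H4 => /(simE _ _ _ NN1).
  move=> [H3 H4]; apply/elemE; apply: H2; split=> [a|a b].
    by apply/elemE; rewrite -(classE _ _ _ a NN1).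
  by move=> nab; move/(simE _ _ _ NN2); apply: H4 => /(simE _ _ _ NN1).
- by exists (Structure M'); split=> //; exact: (@models_self _ _ _ M').
- move=> N1' N2' /comp[N1 [N1M NN1]] sep1 loc1 /comp[N2 [N2M NN2]] sep2 loc2.
  have [|a b||a b|f fiso] := T5 (Structure N1) (Structure N2) N1M _ _ N2M.
  + exact: sep NN1 sep1.
  + exact/(simE _ _ _ NN1)/loc1.
  + exact: sep NN2 sep2.
  + exact/(simE _ _ _ NN2)/loc2.
  exists f; apply: elementary_isomorphism; first by case: fiso.
  apply: (companion_elementary red NN1 NN2); exact: isomorphism_elementary.
Qed.

End Transfer.

(** * Saturation and back-and-forth *)

Section Saturation.
Context {R : realType} (U : set_system nat) {UU : UltraFilter U}.
Hypothesis U_free : forall k, U [set i | (k <= i)%N].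

(** The diagonal argument for countable saturation: coordinate [i] meets the strongest of the
    conditions [P 0], ..., [P i] that can be met there, and freeness of [U] makes almost every [i]
    exceed a given [k]. *)
Lemma diagonal_choice (A : Type) (P : nat -> nat -> A -> Prop) : inhabited A ->
  (forall k i y, P k.+1 i y -> P k i y) ->
  (forall k, U [set i | exists y, P k i y]) ->
  exists y : nat -> A, forall k, U [set i | P k i (y i)].
Proof.
move=> [a0] decr UP.
have decr' k l i y : (k <= l)%N -> P l i y -> P k i y.
  by move=> /subnKC <-; elim: (l - k)%N => [|m IH]; rewrite ?addn0// addnS => /decr.
have /choice[y hy] : forall i, exists y, forall k, (k <= i)%N -> (exists z, P k i z) -> P k i y.
  move=> i; suff : forall m, exists y, forall k, (k <= m)%N -> (exists z, P k i z) -> P k i y.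
    exact.
  elim=> [|m [y hy]].
    have [[z Pz]|nz] := pselect (exists z, P 0%N i z).
      by exists z => k; rewrite leqn0 => /eqP ->.
    by exists a0 => k; rewrite leqn0 => /eqP ->.
  have [[z Pz]|nz] := pselect (exists z, P m.+1 i z).
    by exists z => k km _; exact: decr' km Pz.
  by exists y => k; rewrite leq_eqVlt => /predU1P[->//|]; exact: hy.
exists y => k; have UF : Filter U by exact: filter_filter.
by apply: filterS2 (U_free k) (UP k) => i ki; exact: hy.
Qed.

Context {A : Type} (d : A -> A -> \bar R) (dm : generalised_metric d).
Context {L : language R} (M : structure_on L A) (dM : dist M = d).
Hypothesis M_separable : forall n, exists psi : nat -> formula L n,
  forall (chi : formula L n) (e : R), 0 < e ->
    exists k, forall v, value_dist (eval M chi v) (eval M (psi k) v) <= e.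

Local Notation W := (upow U dm dM).

Lemma upow_saturated m (a b : 'I_m -> ultrapower (U := U) dm) :
  (forall chi, eval W chi a = eval W chi b) ->
  forall x, exists y, forall chi, eval W chi (env_cons x a) = eval W chi (env_cons y b).
Proof.
move=> ab x; have [psi hpsi] := M_separable m.+1.
pose r j := eval W (psi j) (env_cons x a).
pose br i k := urepr (b k) i.
pose P k i y := forall j, (j < k)%N ->
  value_dist (eval M (psi j) (env_cons y (br i))) (r j) < k.+1%:R^-1.
have [|k i y Pk j jk|k|y hy] := @diagonal_choice A P.
- exact: str_inhabited M.
- apply: lt_trans (Pk j (ltn_trans jk (ltnSn _))) _.
  by rewrite ltf_pV2 ?posrE ?ltr0n// ltr_nat.
(* The deviations from the type of [x] over [a] are summed into one formula. By [x] its infimum at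
   [a] is at most 0; [ab] carries this to [b], and Łoś's theorem to almost every coordinate. *)
- pose far (p : 'I_k -> \bar R) := \sum_(j < k) value_dist (p j) (r j).
  have far_cont : continuous (fun p : {ptws 'I_k -> \bar R} => expand (far p)).
    (* [k.+1] rather than [k] keeps the Lipschitz constant positive when [k = 0]. *)
    apply: (@expand_continuous _ _ _ k.+1%:R); first by rewrite ltr0n.
    move=> p q c c0 pq; apply: (@le_trans _ _ (\sum_(j < k) (value_dist (q j) (r j) + c))).
      apply: ler_sum => j _; have := value_dist_triangle (q j) (p j) (r j).
      by have := pq j; lra.
    rewrite big_split /= lerD2l sumr_const card_ord -(mulr_natl c k) ler_pM2r// ler_nat.
    exact: leqnSn.
  pose theta : formula L m.+1 := Conn far_cont (fun j => psi j).
  have : (eval W (Inf theta) b < expand k.+1%:R^-1)%E.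
    rewrite -ab; apply: (@le_lt_trans _ _ (eval W theta (env_cons x a))).
      by apply: ereal_inf_lbound; exists x.
    rewrite /= /far (eq_bigr (fun=> 0)) => [|j _]; last exact: value_distxx.
    rewrite sumr_const mul0rn -lt_contract !contract_expand.
    have := invSn_gt0 R k; set t := _^-1 => t0.
    by do !case: ifPn => //; lra.
  rewrite losr => /ulim_lt; have UF : Filter U by exact: filter_filter.
  apply: filterS => i /= /ereal_inf_lt[_ [y _ <-]] ylt; exists y => j jk.
  have : far (fun j => eval M (psi j) (env_cons y (br i))) < k.+1%:R^-1.
    by rewrite ltNge; apply/negP => /(le_expand); rewrite leNgt => /negP; apply.
  apply: le_lt_trans; rewrite /far (bigD1 (Ordinal jk))//= lerDl.
  by apply: sumr_ge0 => *; exact: value_dist_ge0.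
exists (ucls dm y) => chi.
have yE j : eval W (psi j) (env_cons (ucls dm y) b) = r j.
  have -> : env_cons (ucls dm y) b =
      fun k => ucls dm (env_cons y (fun k' i => urepr (b k') i) k).
    apply/funext => k; case: (unliftP ord0 k) => [k' ->|->].
      by rewrite !env_consS ucls_repr.
    by rewrite !env_cons0.
  rewrite los; apply: ulim_unique => e e0; have [N hN] := invSn_lt e0.
  have UF : Filter U by exact: filter_filter.
  apply: filterS (hy (maxn N j.+1)) => i /(_ j) /=.
  rewrite leq_max ltnSn orbT => /(_ isT) H.
  have -> : (fun k => env_cons y (fun k' i => urepr (b k') i) k i) = env_cons (y i) (br i).
    by apply/funext => k; case: (unliftP ord0 k) => [k' ->|->]; rewrite ?env_consS ?env_cons0.
  by apply/ltW/(lt_trans H)/hN; rewrite leq_maxl.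
apply: value_dist_eq0 => e e0; have e20 : 0 < e / 2 by rewrite divr_gt0.
have WM : models (theory_of M) W by exact: upow_models.
have [k /(theory_of_value_dist WM) hk] := hpsi chi _ e20.
have := hk (env_cons x a); have := hk (env_cons (ucls dm y) b); rewrite yE -/(r k).
have := value_dist_triangle (r k) (eval W chi (env_cons x a))
  (eval W chi (env_cons (ucls dm y) b)).
by rewrite (value_distC (r k) (eval W chi (env_cons (ucls dm y) b))); lra.
Qed.

End Saturation.

Section BackAndForth.
Context {R : realType} {L L' : language R} {K : Type}.
Variables (W : structure_on L K) (W' : structure_on L' K).
Hypothesis W'_saturated : forall m (a b : 'I_m -> K),
  (forall chi, eval W' chi a = eval W' chi b) ->
  forall x, exists y, forall chi, eval W' chi (env_cons x a) = eval W' chi (env_cons y b).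
Hypothesis W_separable : forall n, exists phi : nat -> formula L n,
  forall (psi : formula L n) (e : R), 0 < e ->
    exists k, forall v, value_dist (eval W psi v) (eval W (phi k) v) <= e.

Definition side (b : bool) (q : K * K) : K := if b then q.1 else q.2.

Definition partial_elementary k (p : nat -> K * K) := forall chi : formula L' k,
  eval W' chi (fun i => (p i).1) = eval W' chi (fun i => (p i).2).

Lemma partial_elementary_extend k p (b : bool) x : partial_elementary k p ->
  exists q, [/\ partial_elementary k.+1 q, forall i, (i < k)%N -> q i = p i &
    side b (q k) = x].
Proof.
move=> pk.
have [xy hxy xyE] : exists2 xy : K * K, forall chi : formula L' k.+1,
    eval W' chi (env_cons xy.1 (fun i => (p i).1)) =
    eval W' chi (env_cons xy.2 (fun i => (p i).2)) & side b xy = x.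
  case: b; first by have [y hy] := W'_saturated pk x; exists (x, y).
  have [y hy] := W'_saturated (fun chi => esym (pk chi)) x.
  by exists (y, x) => // chi; rewrite hy.
pose q i := if (i < k)%N then p i else xy.
exists q; split=> [chi|i ik|]; rewrite 1?/q ?ik ?ltnn//.
(* [env_cons] puts the new entry at index 0, while [q] has it at index [k]; [s] is the renaming
   between the two. *)
pose s (i : 'I_k.+1) : 'I_k.+1 := if insub (val i) is Some j then lift ord0 (j : 'I_k) else ord0.
have qs b' : (fun i : 'I_k.+1 => side b' (q i)) =
    env_cons (side b' xy) (fun i => side b' (p i)) \o s.
  apply/funext => i; rewrite /q /s /=; case: insubP => [j ij ji|ni].
    have -> : (i < k)%N = true by exact: ij.
    by rewrite env_consS; congr (side b' (p _)).
  have -> : (i < k)%N = false by exact: negbTE.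
  by rewrite env_cons0.
have := hxy (rename s chi); rewrite !eval_rename.
by rewrite -[env_cons xy.1 _ \o s](qs true) -[env_cons xy.2 _ \o s](qs false).
Qed.

(** The pairs preserve [L']-formulas only, but the witnesses answer [L]-formulas, so that the
    enumerated points are dense in an [L]-elementary substructure. Parameters may come from either
    side and the witness is demanded on either side, which gives both sides the same closure. *)
Lemma back_and_forth n (c e : 'I_n -> K) :
  (forall chi, eval W' chi c = eval W' chi e) ->
  exists p : nat -> K * K, [/\ forall i : 'I_n, p i = (c i, e i),
    forall k, partial_elementary k p &
    forall b N (phi : formula L N.+1) (v : 'I_N -> K) (r : R),
      (forall i, exists b' k, v i = side b' (p k)) -> 0 < r ->
      exists k, contract (eval W phi (env_cons (side b (p k)) v)) <=
        contract (eval W (Inf phi) v) + r].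
Proof.
move=> ce; have [x0] := str_inhabited W.
have [phi hphi] : exists phi : forall n, nat -> formula L n,
    forall n (psi : formula L n) (e : R), 0 < e ->
      exists k, forall v, value_dist (eval W psi v) (eval W (phi n k) v) <= e.
  by exists (fun n => projT1 (cid (W_separable n))) => m; exact: projT2 (cid (W_separable m)).
have /choice[wit hwit] : forall t : {N : nat & ('I_N -> K) * (nat * nat)}, exists y,
    contract (eval W (phi (tag t).+1 (tagged t).2.1) (env_cons y (tagged t).1)) <
    contract (eval W (Inf (phi (tag t).+1 (tagged t).2.1)) (tagged t).1) +
      (tagged t).2.2.+1%:R^-1.
  move=> [N [v [j m]]] /=.
  exact: (ereal_inf_near (fun y => eval W (phi N.+1 j) (env_cons y v)) (inhabits x0)
    (invSn_gt0 R m)).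
(* A task consists of a side, a number of parameters, an index of a formula, a precision and the
   places of the parameters among the pairs. Places instead of points make tasks countable. *)
pose vals (p : nat -> K * K) N (s : seq (bool * nat)) : 'I_N -> K :=
  fun i => let z := nth (true, 0%N) s i in side z.1 (p z.2).
pose target p (t : bool * (nat * (nat * (nat * seq (bool * nat))))) : K :=
  wit (Tagged (fun N => ('I_N -> K) * (nat * nat))%type
    (vals p t.2.1 t.2.2.2.2, (t.2.2.1, t.2.2.2.1))).
(* Step [k] handles the task with code [logn 2 k], so that every task recurs
   infinitely often. *)
have /choice[F hF] : forall kp : nat * (nat -> K * K), exists q,
    partial_elementary (n + kp.1) kp.2 ->
    [/\ partial_elementary (n + kp.1).+1 q,
      forall i, (i < n + kp.1)%N -> q i = kp.2 i &
      forall t, unpickle (logn 2 kp.1) = Some t -> side t.1 (q (n + kp.1)%N) = target kp.2 t].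
  move=> [k p] /=; have [pk|npk] := pselect (partial_elementary (n + k) p); last by exists p.
  case: (unpickle (logn 2 k)) => [t|].
    have [q [q1 q2 q3]] := partial_elementary_extend t.1 (target p t) pk.
    by exists q => _; split=> // _ [<-].
  by have [q [q1 q2 q3]] := partial_elementary_extend true x0 pk; exists q.
pose p0 i := if insub i is Some j then (c j, e j) else (x0, x0).
have p0E (i : 'I_n) : p0 i = (c i, e i).
  by rewrite /p0; case: insubP => [j _ /val_inj -> //|]; rewrite ltn_ord.
pose st := fix st k := if k is k'.+1 then F (k', st k') else p0.
have st_elem k : partial_elementary (n + k) (st k).
  elim: k => [|k IH]; last by rewrite addnS; have [] := hF (k, st k) IH.
  rewrite addn0 => chi; have := ce chi.
  by congr (_ = _); congr eval; apply/funext => i; rewrite /= p0E.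
have st_stable k l i : (k <= l)%N -> (i < n + k)%N -> st l i = st k i.
  move=> /subnKC <-; elim: (l - k)%N => [|m IH] ik; first by rewrite addn0.
  rewrite addnS /=; have [_ keep _] := hF (k + m, st (k + m))%N (st_elem _).
  rewrite keep; first exact: IH.
  by apply: leq_trans ik _; rewrite /= addnA leq_addr.
(* Stage [k] settles the entries below [n + k]; as [n] may be 0, entry [i] is safe only from stage
   [i.+1] on. *)
pose p i := st i.+1 i.
have pE k i : (i < n + k)%N -> p i = st k i.
  move=> ik; have [lt|lt] := leqP i.+1 k.
    by rewrite /p (st_stable _ _ _ lt)// addnS ltnS leq_addl.
  by rewrite /p; apply: st_stable => //; exact: ltnW.
exists p; split.
- by move=> i; rewrite (pE 0%N)// ?addn0//= p0E.
- move=> k chi; have kE (i : 'I_k) : p i = st k i.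
    by apply: pE; apply: leq_trans (ltn_ord i) _; rewrite leq_addl.
  have := st_elem k.
  have wE b : (fun i : 'I_k => side b (p i)) =
      (fun i : 'I_(n + k) => side b (st k i)) \o (fun i : 'I_k => widen_ord (leq_addl n k) i).
    by apply/funext => i /=; rewrite kE.
  move=> /(_ (rename (fun i : 'I_k => widen_ord (leq_addl n k) i) chi)).
  by rewrite !eval_rename -(wE true) -(wE false).
- move=> b N psi v r vp r0; have r40 : 0 < r / 4 by rewrite divr_gt0.
  have [j hj] := hphi _ psi _ r40; have [m /(_ m (leqnn _)) hm] := invSn_lt r40.
  have /choice[z hz] : forall i, exists z : bool * nat, v i = side z.1 (p z.2).
    by move=> i; have [b' [k ->]] := vp i; exists (b', k).
  pose s := [seq z i | i <- enum 'I_N].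
  have sE (i : 'I_N) : nth (true, 0%N) s i = z i.
    by rewrite (nth_map i) ?size_enum_ord// nth_ord_enum.
  pose t := (b, (N, (j, (m, s)))).
  pose B := (\max_(i < N) (z i).2)%N.
  (* The odd cofactor leaves the 2-adic valuation equal to the code of [t] and makes [k] exceed [B],
     so that all parameters are present by stage [k]. *)
  pose k := (2 ^ pickle t * B.*2.+1)%N.
  have kt : logn 2 k = pickle t.
    by rewrite /k lognM ?expn_gt0// pfactorK// logn_coprime ?addn0// coprime2n /= odd_double.
  have zk i : ((z i).2 < n + k)%N.
    apply: (@leq_trans k); last exact: leq_addl.
    apply: (@leq_trans B.*2.+1); last by rewrite leq_pmull// expn_gt0.
    rewrite ltnS -addnn; apply: (@leq_trans B); last exact: leq_addr.
    by rewrite /B (bigD1 i)//= leq_maxl.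
  have vE : vals (st k) N s = v.
    by apply/funext => i; rewrite /vals sE hz -(pE _ _ (zk i)).
  have [_ _ /(_ t)] := hF (k, st k) (st_elem k); rewrite /= kt pickleK => /(_ erefl).
  have -> : F (k, st k) = st k.+1 by [].
  rewrite -(pE k.+1) ?addnS// /target /= vE => pk.
  exists (n + k)%N; rewrite pk.
  set y := wit _.
  have H : contract (eval W (phi N.+1 j) (env_cons y v)) <
      contract (eval W (Inf (phi N.+1 j)) v) + r / 4.
    apply: lt_trans (hwit (Tagged (fun N => ('I_N -> K) * (nat * nat))%type (v, (j, m)))) _.
    by rewrite ltrD2l.
  have [? ?] := value_dist_abs (hj (env_cons y v)).
  have infE : value_dist (eval W (Inf psi) v) (eval W (Inf (phi N.+1 j)) v) <= r / 4.
    by apply: value_dist_inf => [|a]; [exact: ltW|exact: hj].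
  have [? ?] := value_dist_abs infE.
  lra.
Qed.

End BackAndForth.

(** * Reducts with the same automorphism group *)

Lemma bijective_inv (A B : Type) (f : A -> B) : bijective f ->
  exists2 g, cancel f g & cancel g f.
Proof. by case=> g fg gf; exists g. Qed.

Section ReductWithSameAutomorphisms.
Context {R : realType} {L L' : language R} {A : Type}.
Variables (M : structure_on L A) (M' : structure_on L' A).
Hypothesis M_cat : locally_aleph0_categorical M.
Hypothesis M_loc : localising_metric (theory_of M) (fun N : structure L => dist N).
Hypothesis M'_reduct : reduct M' M.
Hypothesis same_metric : forall a b : A, dist M' a b = dist M a b.
Hypothesis same_aut : forall f : A -> A, automorphism M' f <-> automorphism M f.

Let MM : companion M M' M M'. Proof. by []. Qed.

(* Each class of [S] is a copy of [M]; through these copies the restriction of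
   [g] to a class becomes an automorphism of [M'], hence one of [M]. *)
Lemma reduct_automorphism_elementary (S : structure L) (S' : structure_on L' S) g :
  models (theory_of M) S -> separable S -> companion M M' S S' ->
  bijective g -> elementary S' S' g -> elementary S S g.
Proof.
move=> SM sepS SS' /bijective_inv[gi gK giK] gS'.
have [[_ [T1 T2 T3 _ T5]] sepM locM] := M_cat; have [_ _ loc] := M_loc.
have gd x y : dist S (g x) (g y) = dist S x y.
  by rewrite -!SS'.1; exact: (elementary_dist gS').
(* Here the localising metric enters: [g] preserves distances, and finite distance is ~. *)
have simg a b : sim (theory_of M) S (g a) (g b) <-> sim (theory_of M) S a b.
  by rewrite -!loc// gd.
have [_ sC sT] := T1 S SM.
have classiso a : exists (S1 : structure_on L {x : S | sim_class (theory_of M) S a x})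
    (S1' : structure_on L' {x : S | sim_class (theory_of M) S a x}) f,
    [/\ elementary S1 S (@proj1_sig _ _), elementary S1' S' (@proj1_sig _ _),
      isomorphism S1 M f & elementary S1' M' f].
  have [S1 S1S] := T2 S SM a; have [S1' [SS1' S1S']] := companion_sub M'_reduct SS' S1S.
  have S1M : models (theory_of M) S1 by apply/(elementary_models _ S1S).
  have sep1 : separable S1 by apply: separable_sub (elementary_dist S1S) sepS.
  have loc1 : local (theory_of M) S1.
    move=> x y; have : sim (theory_of M) S (proj1_sig x) (proj1_sig y).
      by apply: sT (proj2_sig y); apply: sC; exact: (proj2_sig x).
    rewrite /sim; congr isolated; apply/funext => phi; rewrite /tp -S1S//.
    by congr eval; apply/funext => i /=; case: ifP.
  have [f fiso] := T5 (Structure S1) (Structure M) S1M sep1 loc1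
    (@models_self _ _ _ M) sepM locM.
  exists S1, S1', f; split=> //.
  exact: (companion_elementary M'_reduct SS1' MM (isomorphism_elementary fiso)).
(* Elementarity is now needed only for tuples inside one class, since [g] keeps distinct classes
   apart. *)
apply: (T3 S S SM SM g).2; split; last by move=> a b nab /simg.
move=> a n phi v va.
have [S1 [S1' [f1 [S1S S1S' f1iso f1']]]] := classiso a.
have [S2 [S2' [f2 [S2S S2S' f2iso f2']]]] := classiso (g a).
have gh (x : {x : S | sim_class (theory_of M) S a x}) :
  sim_class (theory_of M) S (g a) (g (proj1_sig x)) by apply/simg; exact: proj2_sig x.
have gih (y : {y : S | sim_class (theory_of M) S (g a) y}) :
  sim_class (theory_of M) S a (gi (proj1_sig y)).
  by apply/simg; rewrite giK; exact: proj2_sig y.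
pose h x := exist _ _ (gh x); pose hi y := exist _ _ (gih y).
have hbij : bijective h.
  by exists hi => x; apply: proj1_sig_inj => /=; rewrite ?gK ?giK.
have [f1b _ _ _] := f1iso; have [f2b _ _ _] := f2iso.
have [k1 f1K k1K] := bijective_inv f1b.
pose theta := f2 \o h \o k1.
have theta_bij : bijective theta.
  by apply: bij_comp; [exact: bij_comp|exists f1].
have thetaM' : elementary M' M' theta.
  move=> m psi w _.
  have -> : theta \o w = f2 \o (h \o (k1 \o w)) by [].
  rewrite f2'// -S2S'//.
  have -> : @proj1_sig _ _ \o (h \o (k1 \o w)) = g \o (@proj1_sig _ _ \o (k1 \o w)) by [].
  rewrite gS'// S1S'// -f1'//; congr eval; apply/funext => i /=; exact: k1K.
have /same_aut thetaM : automorphism M' theta by exact: elementary_isomorphism.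
pose v1 i : {x : S | sim_class (theory_of M) S a x} := exist _ (v i) (va i).
have -> : g \o v = (@proj1_sig _ _) \o (h \o v1) by [].
rewrite S2S// -(isomorphism_elementary f2iso phi (v := h \o v1))//.
have -> : f2 \o (h \o v1) = theta \o (f1 \o v1).
  by apply/funext => i; rewrite /theta /= f1K.
rewrite (isomorphism_elementary thetaM)// (isomorphism_elementary f1iso)//.
by rewrite -S1S.
Qed.

Section TypeDetermined.
Context {K : Type} (W : structure_on L K) (W' : structure_on L' K).
Hypothesis WM : models (theory_of M) W.
Hypothesis WW' : companion M M' W W'.
Hypothesis W'_saturated : forall m (a b : 'I_m -> K),
  (forall chi, eval W' chi a = eval W' chi b) ->
  forall x, exists y, forall chi, eval W' chi (env_cons x a) = eval W' chi (env_cons y b).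

Let Wm := dist_metric W.

(** The back-and-forth only matches two sequences of points. [B] is the closure of these points and
    [g] the closure of the matching, which is a bijection of [B] because matched points have equal
    distances. *)
Lemma reduct_type_determines_type n (c e : 'I_n -> K) :
  (forall chi, eval W' chi c = eval W' chi e) -> forall phi, eval W phi c = eval W phi e.
Proof.
move=> ce phi0; have [[sepL _] _ _] := M_cat.
have [|p [p_init p_elem p_tv]] := back_and_forth W'_saturated _ ce (W := W).
  move=> m; have [phi hphi] := sepL m; exists phi => psi r r0.
  by have [k hk] := hphi psi r r0; exists k; exact: (hk (Structure W) WM).
have p_tuple m (s : 'I_m -> nat) (chi : formula L' m) :
    eval W' chi (fun i => (p (s i)).1) = eval W' chi (fun i => (p (s i)).2).
  pose k := (\max_(i < m) s i).+1.
  have sk i : (s i < k)%N by rewrite ltnS /k (bigD1 i)//= leq_maxl.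
  have := p_elem k (rename (fun i => Ordinal (sk i)) chi).
  by rewrite !eval_rename.
have p_dist b k l : dist W (side b (p k)) (side b (p l)) =
    dist W (side (~~ b) (p k)) (side (~~ b) (p l)).
  have := p_tuple 2%N (fun i => if i == ord0 then k else l) (dist_formula ord0 ord_max).
  by rewrite /= !WW'.1; case: b.
pose cl b x := forall r : R, 0 < r -> exists k, (dist W x (side b (p k)) < r%:E)%E.
have cl_p b k : cl b (side b (p k)) by move=> r r0; exists k; exact: gmetric_xx_lt.
(* The distance to [side b (p k)] is a formula with infimum 0, so near-witnesses for it on side [b']
   come arbitrarily close to that point. *)
have cl_switch b b' x : cl b x -> cl b' x.
  move=> bx r r0; have r20 : 0 < r / 2 by rewrite divr_gt0.
  have [k hk] := bx _ r20; pose v (_ : 'I_1) := side b (p k).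
  have c0 : 0 < contract (r / 2)%:E by rewrite -(contract0 R) lt_contract lte_fin.
  have c20 : 0 < contract (r / 2)%:E / 2 by rewrite divr_gt0.
  have [i|l hl] := p_tv b' 1%N (dist_formula ord0 ord_max) v _ _ c20.
    by exists b, k.
  have E x' : eval W (dist_formula ord0 ord_max) (env_cons x' v) = dist W x' (side b (p k)).
    rewrite /= env_cons0; have -> : ord_max = lift ord0 (ord0 : 'I_1) by exact/val_inj.
    by rewrite env_consS.
  exists l; rewrite [r]splitr; apply: (gmetric_lt_trans Wm hk).
  rewrite (gmetricC Wm) -lt_contract -E.
  have inf0 : contract (eval W (Inf (dist_formula ord0 ord_max)) v) <= 0.
    rewrite -(contract0 R) le_contract -(gmetric_xx Wm (side b (p k))) -E.
    by apply: ereal_inf_lbound; exists (side b (p k)).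
  lra.
pose B := {x : K | cl true x}.
have B_complete : metric_complete (fun x y : B => dist W (proj1_sig x) (proj1_sig y)).
  move=> u cu; have [x hx] := dist_complete (s := W) cu.
  suff clx : cl true x by exists (exist _ x clx).
  move=> r r0; have r20 : 0 < r / 2 by rewrite divr_gt0.
  have [N hN] := hx _ r20; have [k hk] := proj2_sig (u N) _ r20; exists k.
  rewrite [r]splitr; apply: (gmetric_lt_trans Wm (y := proj1_sig (u N))) => //.
  by rewrite (gmetricC Wm) hN.
have B_tv m (phi : formula L m.+1) (v : 'I_m -> B) (r : R) : 0 < r -> exists b : B,
    contract (eval W phi (env_cons (proj1_sig b) (@proj1_sig _ _ \o v))) <=
    contract (eval W (Inf phi) (@proj1_sig _ _ \o v)) + r.
  move=> r0; have r40 : 0 < r / 4 by rewrite divr_gt0.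
  have [d d0 hd] := eval_uc W phi r40.
  have /choice[k hk] := fun i => proj2_sig (v i) _ d0.
  (* Near-witnesses are available only over enumerated parameters, so [v] is first moved to such a
     tuple by uniform continuity. *)
  pose v' i := side true (p (k i)).
  have vv' x : value_dist (eval W phi (env_cons x (@proj1_sig _ _ \o v)))
      (eval W phi (env_cons x v')) <= r / 4.
    apply: hd => i; case: (unliftP ord0 i) => [i' ->|->].
      by rewrite !env_consS; exact: hk.
    by rewrite !env_cons0; exact: gmetric_xx_lt.
  have infE : value_dist (eval W (Inf phi) (@proj1_sig _ _ \o v)) (eval W (Inf phi) v') <= r / 4.
    by apply: value_dist_inf => [|x]; [exact: ltW|exact: vv'].
  have [|l hl] := p_tv true m phi v' _ _ r40; first by move=> i; exists true, (k i).
  exists (exist _ _ (cl_p true l)).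
  have [? ?] := value_dist_abs infE; have [? ?] := value_dist_abs (vv' (side true (p l))).
  move: hl; set s1 := eval W (Inf phi) v' in infE *; set s2 := eval W (Inf phi) _ in infE *.
  rewrite [X in _ -> X]/=; lra.
have [S SW] := tarski_vaught (inhabits (exist _ _ (cl_p true 0%N)))
  (@proj1_sig_inj _ _) B_complete B_tv.
have [S' [SS' S'W']] := companion_sub M'_reduct WW' SW.
have SM : models (theory_of M) S by apply/(elementary_models _ SW).
have sepS : separable S.
  exists (fun k => exist _ _ (cl_p true k)) => x r r0; have [k hk] := proj2_sig x r r0.
  by exists k; rewrite -(elementary_dist SW) (gmetricC Wm).
(* The closure of the matching, read from side [b] to the other: one [k] must approximate both
   points at once. *)
pose G b x y := forall r : R, 0 < r -> exists k,
  (dist W x (side b (p k)) < r%:E)%E /\ (dist W y (side (~~ b) (p k)) < r%:E)%E.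
have G_total b x : cl b x -> exists y, G b x y.
  move=> bx; have /choice[k hk] := fun m => bx _ (invSn_gt0 R m).
  have [r r0|y hy] := dist_complete (s := W) (u := fun m => side (~~ b) (p (k m))).
    have r20 : 0 < r / 2 by rewrite divr_gt0.
    have [N hN] := invSn_lt r20; exists N => m m' Nm Nm'; rewrite -p_dist [r]splitr.
    apply: (gmetric_lt_trans Wm (y := x)).
      by rewrite (gmetricC Wm); apply: lt_trans (hk m) _; rewrite lte_fin hN.
    by apply: lt_trans (hk m') _; rewrite lte_fin hN.
  exists y => r r0; have [N hN] := invSn_lt r0; have [N' hN'] := hy r r0.
  exists (k (maxn N N')); split.
    by apply: lt_trans (hk _) _; rewrite lte_fin hN// leq_maxl.
  by rewrite (gmetricC Wm) hN'// leq_maxr.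
have G_elem m (chi : formula L' m) (x y : 'I_m -> K) : (forall i, G true (x i) (y i)) ->
    eval W' chi x = eval W' chi y.
  move=> xy; apply: value_dist_eq0 => r r0; have r20 : 0 < r / 2 by rewrite divr_gt0.
  have [d d0 hd] := eval_uc W' chi r20; have /choice[k hk] := fun i => xy i _ d0.
  have H1 : value_dist (eval W' chi x) (eval W' chi (fun i => (p (k i)).1)) <= r / 2.
    by apply: hd => i; rewrite WW'.1; have [] := hk i.
  have H2 : value_dist (eval W' chi y) (eval W' chi (fun i => (p (k i)).2)) <= r / 2.
    by apply: hd => i; rewrite WW'.1; have [] := hk i.
  rewrite -p_tuple value_distC in H2.
  have := value_dist_triangle (eval W' chi (fun i => (p (k i)).1)) (eval W' chi x)
    (eval W' chi y).
  lra.
have G_dist x y x' y' : G true x y -> G true x' y' -> dist W x x' = dist W y y'.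
  move=> xy xy'; have := G_elem _ (dist_formula ord0 ord_max)
    (fun i : 'I_2 => if i == ord0 then x else x') (fun i => if i == ord0 then y else y').
  by rewrite /= !WW'.1; apply => i; case: ifP.
have [_ dist0 _ _] := Wm.
have G_fun x y y' : G true x y -> G true x y' -> y = y'.
  by move=> xy xy'; apply/dist0; rewrite -(G_dist _ _ _ _ xy xy') (gmetric_xx Wm).
have G_inj x x' y : G true x y -> G true x' y -> x = x'.
  by move=> xy xy'; apply/dist0; rewrite (G_dist _ _ _ _ xy xy') (gmetric_xx Wm).
have /choice[g hg] : forall x : B, exists y : B, G true (proj1_sig x) (proj1_sig y).
  move=> [x clx]; have [y xy] := G_total true x clx.
  suff cly : cl true y by exists (exist _ y cly).
  by apply: (cl_switch false) => r /xy[k [_ ?]]; exists k.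
have /choice[h hh] : forall y : B, exists x : B, G true (proj1_sig x) (proj1_sig y).
  move=> [y cly]; have [x yx] := G_total false y (cl_switch _ false _ cly).
  have clx : cl true x by move=> r /yx[k [_ ?]]; exists k.
  by exists (exist _ x clx) => r /yx[k [? ?]]; exists k.
have g_bij : bijective g.
  exists h => x; apply: proj1_sig_inj; first exact: G_inj (hh (g x)) (hg x).
  exact: G_fun (hg (h x)) (hh x).
have gS' : elementary S' S' g.
  move=> m chi v _; rewrite -(S'W' _ chi v)// -(S'W' _ chi (g \o v))//.
  by apply/esym/G_elem => i; exact: hg.
have gS : elementary S S g.
  exact: (reduct_automorphism_elementary (S := Structure S)) gS'.
have clc i : cl true (c i).
  by move=> r r0; exists i; rewrite p_init; exact: gmetric_xx_lt.
pose cB i : B := exist _ (c i) (clc i).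
have gcB : @proj1_sig _ _ \o (g \o cB) = e.
  apply/funext => i /=; apply: G_fun (hg (cB i)) _ => r r0; exists i.
  by rewrite p_init /=; split; exact: gmetric_xx_lt.
by rewrite -gcB SW// gS// -SW.
Qed.

End TypeDetermined.

(** Compactness: counterexamples for all [k] would form two tuples of the ultrapower with the same
    [L']-type whose values of [phi] differ by at least [e]. *)
Lemma reduct_formulas_separate n (phi : formula L n) (psi : nat -> formula L' n) (e : R) :
  (forall (chi : formula L' n) (r : R), 0 < r ->
    exists k, forall v, value_dist (eval M' chi v) (eval M' (psi k) v) <= r) -> 0 < e ->
  exists k, forall v w,
    (forall j, (j < k)%N -> value_dist (eval M' (psi j) v) (eval M' (psi j) w) < k.+1%:R^-1) ->
    value_dist (eval M phi v) (eval M phi w) < e.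
Proof.
move=> psi_dense e0; apply: contrapT => /forallNP nk.
have /choice[f hf] : forall k, exists vw : ('I_n -> A) * ('I_n -> A),
    (forall j, (j < k)%N ->
      value_dist (eval M' (psi j) vw.1) (eval M' (psi j) vw.2) < k.+1%:R^-1) /\
    e <= value_dist (eval M phi vw.1) (eval M phi vw.2).
  move=> k; have /existsNP[v /existsNP[w /not_implyP[H1 /negP H2]]] := nk k.
  by exists (v, w); split=> //; rewrite leNgt.
have [U [UU U_free]] := nat_ultrafilter; have UF : Filter U by exact: filter_filter.
have dM' : dist M' = dist M by apply/funext => x; exact/funext.
pose W := upow U (UU := UU) (dist_metric M) (erefl (dist M)).
pose W' := upow U (UU := UU) (dist_metric M) dM'.
have WM : models (theory_of M) W by exact: upow_models.
have WW' : companion M M' W W' by exact: upow_companion.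
have [[sepL _] _ _] := M_cat.
have sat := upow_saturated (UU := UU) U_free (dm := dist_metric M) (dM := dM')
  (reduct_separable M'_reduct sepL).
pose c i := ucls (UU := UU) (dist_metric M) (fun k => (f k).1 i).
pose c' i := ucls (UU := UU) (dist_metric M) (fun k => (f k).2 i).
have cc' chi : eval W' chi c = eval W' chi c'.
  rewrite /W' /c /c' !los; apply: value_dist_eq0 => r r0.
  have r30 : 0 < r / 3 by rewrite divr_gt0.
  have [j hj] := psi_dense chi _ r30; have [N hN] := invSn_lt r30.
  apply: ulim_value_dist_le; apply: filterS (U_free (maxn N j.+1)) => k /=.
  rewrite geq_max => /andP[Nk jk]; have [/(_ j jk) H _] := hf k; have := hN k Nk.
  have := hj (f k).1; have := hj (f k).2.
  have := value_dist_triangle (eval M' (psi j) (f k).1) (eval M' chi (f k).1)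
    (eval M' chi (f k).2).
  have := value_dist_triangle (eval M' (psi j) (f k).2) (eval M' (psi j) (f k).1)
    (eval M' chi (f k).2).
  rewrite (value_distC (eval M' (psi j) (f k).2) (eval M' chi (f k).2)).
  by move: H; set t := _^-1 => *; lra.
have := reduct_type_determines_type WM WW' sat cc' phi.
rewrite /W /c /c' !los => E.
have e20 : 0 < e / 2 by rewrite divr_gt0.
have [k /= [H1 H2]] := ultra_ex (ultraI
  (ulim_near (UU := UU) (fun k => eval M phi (f k).1) e20)
  (ulim_near (UU := UU) (fun k => eval M phi (f k).2) e20)).
move: H1 H2; rewrite E; set l := ulim U (fun k => eval M phi (f k).2) => H1 H2.
have [_] := hf k; have := value_dist_triangle l (eval M phi (f k).1) (eval M phi (f k).2).
by rewrite (value_distC l); lra.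
Qed.

(* The inf-convolution of [phi] with a steep penalty in the values of finitely
   many formulas of [M'] is a connective applied to these formulas. *)
Lemma reduct_formula_approx n (phi : formula L n) (e : R) : 0 < e ->
  exists chi : formula L' n, forall v, value_dist (eval M phi v) (eval M' chi v) <= e.
Proof.
move=> e0; have [[sepL _] _ _] := M_cat.
have [psi psi_dense] := reduct_separable M'_reduct sepL n.
have [k hk] := reduct_formulas_separate phi psi_dense e0.
(* [contract] oscillates by at most 2, and a tuple that fails the closeness test for [k] has penalty
   at least [k.+1%:R^-1]; the factor [C] raises this to 2, so such tuples cannot pull the infimum
   below the value of [phi] at [w]. *)
have [a0] := str_inhabited M; pose C : R := 2 * k.+1%:R.
have C0 : 0 < C by rewrite mulr_gt0// ltr0n.
pose pen (p : 'I_k -> \bar R) v := \sum_(j < k) value_dist (p j) (eval M' (psi j) v).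
have pen0 p v : 0 <= pen p v by apply: sumr_ge0 => *; exact: value_dist_ge0.
pose F p v := contract (eval M phi v) + C * pen p v.
have F_ge p v : -1 <= F p v.
  by have := contract_ge (eval M phi v); have := mulr_ge0 (ltW C0) (pen0 p v); rewrite /F; lra.
pose h p := inf (range (F p)).
have h_le p v : h p <= F p v.
  apply: ge_inf; last by exists v.
  by exists (-1) => _ [w _ <-].
have h_ge p r : (forall v, r <= F p v) -> r <= h p.
  move=> rF; apply: lb_le_inf; first by exists (F p (fun=> a0)), (fun=> a0).
  by move=> _ [w _ <-].
have h_cont : continuous (fun p : {ptws 'I_k -> \bar R} => expand (h p)).
  apply: (@expand_continuous _ _ _ (C * k.+1%:R)); first by rewrite mulr_gt0// ltr0n.
  move=> p q r r0 pq; rewrite -lerBlDr; apply: h_ge => v; rewrite lerBlDr.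
  apply: le_trans (h_le p v) _; rewrite /F -addrA lerD2l -mulrA -mulrDr ler_pM2l//.
  apply: (@le_trans _ _ (\sum_(j < k) (value_dist (q j) (eval M' (psi j) v) + r))).
    apply: ler_sum => j _.
    have := value_dist_triangle (q j) (p j) (eval M' (psi j) v).
    by have := pq j; lra.
  rewrite big_split /= lerD2l sumr_const card_ord -(mulr_natl r k) ler_pM2r// ler_nat.
  exact: leqnSn.
exists (Conn h_cont (fun j => psi j)) => w; set p := fun j : 'I_k => eval M' (psi j) w.
have -> : eval M' (Conn h_cont (fun j => psi j)) w = expand (h p) by [].
rewrite -[eval M phi w]contractK; apply: le_trans (expand_value_dist _ _) _.
rewrite ler_norml; apply/andP; split.
  suff : h p <= contract (eval M phi w) by lra.
  apply: le_trans (h_le p w) _; rewrite /F /pen big1 ?mulr0 ?addr0// => j _.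
  exact: value_distxx.
suff : contract (eval M phi w) - e <= h p by lra.
apply: h_ge => v.
have [near|/existsNP[j /not_implyP[jk /negP far]]] := pselect (forall j, (j < k)%N ->
    value_dist (eval M' (psi j) w) (eval M' (psi j) v) < k.+1%:R^-1).
  have /ltW/value_dist_abs[? _] := hk _ _ near.
  by have := mulr_ge0 (ltW C0) (pen0 p v); rewrite /F; lra.
rewrite -leNgt in far.
have pen_ge : k.+1%:R^-1 <= pen p v.
  apply: le_trans far _; rewrite /pen (bigD1 (Ordinal jk))//= lerDl.
  by apply: sumr_ge0 => *; exact: value_dist_ge0.
have : 2 <= C * pen p v.
  have -> : 2 = C * k.+1%:R^-1 by rewrite /C mulfK// pnatr_eq0.
  by rewrite ler_pM2l.
have := contract_le (eval M phi w); have := contract_ge (eval M phi v).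
rewrite /F; lra.
Qed.

Lemma same_automorphisms_bidefinable : bidefinable M' M.
Proof.
move=> n D; split; first exact: M'_reduct.
move=> DM e e0; have e20 : 0 < e / 2 by rewrite divr_gt0.
have [phi hphi] := DM _ e20; have [chi hchi] := reduct_formula_approx phi e20.
exists chi => v; have := hphi v; have := hchi v.
by have := value_dist_triangle (eval M phi v) (D v) (eval M' chi v); lra.
Qed.

End ReductWithSameAutomorphisms.

Theorem theorem6p4 (R : realType) (L L' : language R) (A : Type)
    (M : structure_on L A) (M' : structure_on L' A)
    (M_cat : locally_aleph0_categorical M)
    (M_loc : localising_metric (theory_of M) (fun N : structure L => dist N))
    (M'_reduct : reduct M' M)
    (same_metric : forall a b : A, dist M' a b = dist M a b)
    (same_aut : forall f : A -> A, automorphism M' f <-> automorphism M f) :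
  locally_aleph0_categorical M' /\ bidefinable M' M.
Proof.
have bid : bidefinable M' M by exact: same_automorphisms_bidefinable.
by split=> //; exact: bidefinable_locally_aleph0_categorical bid same_metric M_cat.
Qed.
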